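(* Let $\alpha\in(-1,0)$ and let $f=\alpha I_2$ acting on $W=\mathbb{C}^2\setminus\{0\}$. The automorphism group $\mathrm{Aut}(H_f,\mathfrak{s}_f)$ of the odd Real Hopf surface $(H_f,\mathfrak{s}_f)$ is naturally isomorphic to the group $$\mathrm{Spin}^c(3)=S^1\times_{\mathbb{Z}_2}\mathrm{Spin}(3)=S^1\times_{\mathbb{Z}_2}\mathrm{SU}(2).$$
   Context: $H_f=W/\langle f\rangle$. $\mathrm{Aut}(H_f,\mathfrak{s}_f)$ is the group of biholomorphisms of $H_f$ commuting with $\mathfrak{s}_f$. Here $\mathfrak{s}_f$ is the anti-holomorphic involution of $H_f$ induced by $J\circ f^{1/2}:W\to W$, where $J(z,w)=(-\bar w,\bar z)$, $f^{1/2}(z,w)=(\alpha^{1/2}z,\alpha^{1/2}w)$ and $\alpha^{1/2}$ is a fixed square root of $\alpha$ (one has $(J\circ f^{1/2})^2=f$). $S^1\times_{\mathbb{Z}_2}\mathrm{SU}(2)$ denotes the quotient of $S^1\times\mathrm{SU}(2)$ by the order $2$ subgroup generated by $(-1,-I_2)$. *)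

(* Defs.v *)
From HB Require Import structures.
From mathcomp Require Import all_boot all_order all_algebra.
From mathcomp Require Import spectral complex.
From mathcomp Require Import all_classical all_reals all_analysis.
Import Order.TTheory GRing.Theory Num.Theory.
Import numFieldNormedType.Exports.

Set Implicit Arguments.
Unset Strict Implicit.
Unset Printing Implicit Defensive.

Local Open Scope classical_set_scope.
Local Open Scope ring_scope.
Local Open Scope quotient_scope.
Local Open Scope complex_scope.

Section HolomorphicMaps.
Context {K : numFieldType} {E : normedModType K} {X : topologicalType}.

(* An atlas is a set of pairs (D, c): a chart domain D and a coordinate map c,
   only meaningful on D.  The coordinate expression of phi is c' \o phi \o c^-1,
   and [differentiable] is K-differentiability, i.e. complex differentiability
   when K is the field of complex numbers. *)
Definition holomorphic_map (atlas : set (set X * (X -> E))) (phi : X -> X) :=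
  continuous phi /\
  forall (D D' : set X) (c c' : X -> E),
    atlas (D, c) -> atlas (D', c') ->
    forall x : X, D x -> D' (phi x) ->
      differentiable (c' \o phi \o 'pinv_(fun=> x) D c) (c x).

Definition biholomorphic_map (atlas : set (set X * (X -> E))) (phi : X -> X) :=
  exists psi : X -> X,
    [/\ cancel phi psi, cancel psi phi,
        holomorphic_map atlas phi & holomorphic_map atlas psi].

End HolomorphicMaps.

(* The norm topology on C, and its structure of normed space over itself. *)
HB.instance Definition _ (R : realType) := NormedModule.copy R[i] R[i]^o.

Section PuncturedPlane.
Context {R : realType}.
Local Notation C := R[i].

Definition punctured_plane : set 'cV[C]_2 := [set v | v != 0].

Definition W : Type := set_type punctured_plane.
HB.instance Definition _ := Topological.on W.

Lemma W_neq0 (v : W) : val v != 0.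
Proof. exact: set_mem (valP v). Qed.

Definition mkW (v : 'cV[C]_2) (hv : v != 0) : W := exist _ v (mem_set hv).

Lemma scaleW_subproof (c : C) (v : W) : c != 0 -> c *: val v != 0.
Proof. by move=> c0; rewrite scaler_eq0 negb_or c0 W_neq0. Qed.

Definition scaleW (c : C) (hc : c != 0) (v : W) : W :=
  mkW (scaleW_subproof v hc).

Definition Jvec (v : 'cV[C]_2) : 'cV[C]_2 :=
  \col_i (if i == 0 then - conjc (v 1 0) else conjc (v 0 0)).

Lemma Jvec_neq0 (v : W) : Jvec (val v) != 0.
Proof.
apply: contra (W_neq0 v) => /eqP Jv0; apply/eqP/matrixP => i j.
have := congr1 (fun M : 'cV[C]_2 => M 0 0) Jv0.
have := congr1 (fun M : 'cV[C]_2 => M 1 0) Jv0.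
rewrite !mxE /= => /eqP; rewrite conjc_eq0 => /eqP v0 /eqP.
rewrite oppr_eq0 conjc_eq0 => /eqP v1.
rewrite (ord1 j); case: i => [[|[|//]]] hi.
  by rewrite -[RHS]v0; congr (val v _ _); apply: val_inj.
by rewrite -[RHS]v1; congr (val v _ _); apply: val_inj.
Qed.

Definition J (v : W) : W := mkW (Jvec_neq0 v).

End PuncturedPlane.
Arguments W R : clear implicits.

Section OrbitRelation.
Context {T : choiceType} (f : T -> T) (f_inj : injective f).

Definition orbit_rel (v w : T) : bool :=
  `[< exists n : nat, w = iter n f v \/ v = iter n f w >].

Lemma orbit_rel_refl : reflexive orbit_rel.
Proof. by move=> v; apply/asboolP; exists 0%N; left. Qed.

Lemma orbit_rel_sym : symmetric orbit_rel.
Proof.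
by move=> v w; apply/asboolP/asboolP => -[n [h|h]]; exists n; [right|left|right|left].
Qed.

Lemma iter_cancel n m (x y : T) : iter n f x = iter m f y ->
  exists k, y = iter k f x \/ x = iter k f y.
Proof.
elim: n m => [|n IHn] [|m] /=.
- by move=> ->; exists 0%N; left.
- by move=> ->; exists m.+1; right.
- by move=> <-; exists n.+1; left.
- by move=> /f_inj /IHn.
Qed.

Lemma orbit_rel_trans : transitive orbit_rel.
Proof.
move=> w v u /asboolP[n hn] /asboolP[m hm]; apply/asboolP; move: hn hm.
case=> [->|->] [->|].
- by exists (m + n)%N; left; rewrite iterD.
- exact: iter_cancel.
- have [/subnK <-|/ltnW/subnK <-] := leqP n m.
    by exists (m - n)%N; left; rewrite iterD.
  by exists (n - m)%N; right; rewrite iterD.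
- by move=> ->; exists (n + m)%N; right; rewrite iterD.
Qed.

Definition orbit_equiv :=
  EquivRel orbit_rel orbit_rel_refl orbit_rel_sym orbit_rel_trans.

End OrbitRelation.

Section Hopf.
Context {R : realType} (alpha : R) (halpha : -1 < alpha < 0).
Local Notation C := R[i].

Lemma alphaC_neq0 : (alpha%:C : C) != 0.
Proof.
rewrite (_ : 0 = 0%:C) // (inj_eq (@complexI _)).
by have /andP[_ /lt_eqF ->] := halpha.
Qed.

Definition hopf_f : W R -> W R := scaleW alphaC_neq0.

Lemma hopf_f_inj : injective hopf_f.
Proof.
move=> v w /(congr1 val) /= h; apply: val_inj.
exact: (scalerI alphaC_neq0) h.
Qed.

Definition Hopf : Type := quotient_topology {eq_quot orbit_equiv hopf_f_inj}.
HB.instance Definition _ := Quotient.on Hopf.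
HB.instance Definition _ := Topological.on Hopf.

Definition hopf_proj (v : W R) : Hopf := \pi_Hopf v.

(* The quotient map is a covering; the charts of the complex surface W / <f> are
   its continuous local sections, composed with the inclusion of W in C^2. *)
Definition hopf_atlas : set (set Hopf * (Hopf -> 'cV[C]_2)) :=
  [set Dc | open Dc.1 /\
     exists s : Hopf -> W R,
       [/\ {within Dc.1, continuous s},
           {in Dc.1, forall x, hopf_proj (s x) = x} &
           Dc.2 = (fun x => val (s x))]].

Section RealStructure.
(* a is the chosen square root of alpha *)
Context (a : C) (ha : a ^+ 2 = alpha%:C).

Lemma sqrt_alpha_neq0 : a != 0.
Proof.
by apply: contraNneq alphaC_neq0 => a0; rewrite -ha a0 expr0n.
Qed.

Definition f_half : W R -> W R := scaleW sqrt_alpha_neq0.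

Definition sf (x : Hopf) : Hopf := hopf_proj (J (f_half (repr x))).

Lemma J_f_half_f (v : W R) : J (f_half (hopf_f v)) = hopf_f (J (f_half v)).
Proof.
apply: val_inj; apply/matrixP => i j; rewrite /= !mxE.
have cM (x y : C) : conjc (x * y) = conjc x * conjc y by exact: rmorphM.
by case: ifP => _; rewrite !cM conjc_real ?mulrN [in LHS]mulrCA.
Qed.

Lemma hopf_projP (v w : W R) :
  hopf_proj v = hopf_proj w <-> exists n, w = iter n hopf_f v \/ v = iter n hopf_f w.
Proof.
rewrite /hopf_proj; split => [/eqmodP/asboolP//|h].
by apply/eqmodP/asboolP.
Qed.

Lemma sf_proj (v : W R) : sf (hopf_proj v) = hopf_proj (J (f_half v)).
Proof.
have Jit n u : J (f_half (iter n hopf_f u)) = iter n hopf_f (J (f_half u)).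
  by elim: n => //= n <-; rewrite J_f_half_f.
have /hopf_projP[n h] : hopf_proj (repr (hopf_proj v)) = hopf_proj v.
  exact: reprK.
apply/hopf_projP; exists n; rewrite -!Jit.
by case: h => h; [left|right]; congr (J (f_half _)).
Qed.

Lemma J_f_half_sq (v : W R) : J (f_half (J (f_half v))) = hopf_f v.
Proof.
have aa : a * conjc a = - alpha%:C.
  have /andP[_ a0] := halpha.
  have : `|a| ^+ 2 = - alpha%:C.
    rewrite -normrX ha normc_def /= expr0n addr0 sqrtr_sqr ltr0_norm//.
    exact: rmorphN.
  by rewrite sqr_normc.
apply: val_inj; apply/matrixP => i j; rewrite /= !mxE.
have cM (x y : C) : conjc (x * y) = conjc x * conjc y by exact: rmorphM.
have cN (x : C) : conjc (- x) = - conjc x by exact: rmorphN.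
rewrite (ord1 j) {j}; case: i => [[|[|//]]] hi /=.
  rewrite !cM !conjcK mulrA [conjc a * a]mulrC aa mulNr opprK.
  by rewrite (_ : Ordinal hi = 0) //; exact: val_inj.
rewrite cM cN conjcK mulrN mulrA [conjc a * a]mulrC aa mulNr opprK.
by rewrite (_ : Ordinal hi = 1) //; exact: val_inj.
Qed.

Lemma sfK : involutive sf.
Proof.
elim/quotW => v; rewrite -/(hopf_proj v) !sf_proj J_f_half_sq.
by apply/hopf_projP; exists 1%N; right.
Qed.

(* The underlying set of the group Aut(H_f, s_f); its law is composition. *)
Definition real_aut : set (Hopf -> Hopf) :=
  [set phi | biholomorphic_map hopf_atlas phi /\ phi \o sf = sf \o phi].

End RealStructure.
End Hopf.

Section CentralInvolutionQuotient.
Context {G : groupType} (z : G).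
Context (hz : (z * z = 1)%g /\ forall x : G, (z * x = x * z)%g).

Let zz : (z * z = 1)%g := hz.1.
Let zC (x : G) : (z * x = x * z)%g := hz.2 x.

Definition cq_rel (x y : G) : bool := (y == x) || (y == (z * x)%g).

Lemma cq_rel_refl : reflexive cq_rel.
Proof. by move=> x; rewrite /cq_rel eqxx. Qed.

Lemma cq_mulzK (x : G) : (z * (z * x) = x)%g.
Proof. by rewrite mulgA zz mul1g. Qed.

Lemma cq_rel_sym : symmetric cq_rel.
Proof.
move=> x y; rewrite /cq_rel eq_sym; congr orb.
by apply/eqP/eqP => ->; rewrite cq_mulzK.
Qed.

Lemma cq_rel_trans : transitive cq_rel.
Proof.
move=> y x w; rewrite /cq_rel.
by move=> /orP[]/eqP-> /orP[]/eqP->; rewrite ?cq_mulzK eqxx ?orbT.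
Qed.

Definition cq_equiv := EquivRel cq_rel cq_rel_refl cq_rel_sym cq_rel_trans.

(* G / <z> for a central element z with z^2 = 1 *)
Definition central_quot : Type := {eq_quot cq_equiv}.
HB.instance Definition _ := Choice.on central_quot.
HB.instance Definition _ := Quotient.on central_quot.

Definition cq_proj (x : G) : central_quot := \pi_central_quot x.
Definition cq_mul (p q : central_quot) := cq_proj (repr p * repr q)%g.
Definition cq_inv (p : central_quot) := cq_proj (repr p)^-1%g.

Lemma cq_projP (x y : G) :
  reflect (y = x \/ y = (z * x)%g) (cq_proj x == cq_proj y).
Proof.
rewrite /cq_proj eqmodE /= /cq_rel.
by apply: (iffP orP) => -[/eqP|/eqP]; [left|right|left|right].
Qed.

Lemma cq_repr (x : G) :
  repr (cq_proj x) = x \/ repr (cq_proj x) = (z * x)%g.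
Proof. by apply/cq_projP; rewrite eq_sym; apply/eqP; exact: reprK. Qed.

Lemma cq_proj_mul (x y : G) : cq_mul (cq_proj x) (cq_proj y) = cq_proj (x * y)%g.
Proof.
apply/eqP; rewrite eq_sym; apply/cq_projP.
have [->|->] := cq_repr x; have [->|->] := cq_repr y.
- by left.
- by right; rewrite !mulgA zC.
- by right; rewrite mulgA.
- by left; rewrite -mulgA (mulgA x z y) -zC -mulgA cq_mulzK.
Qed.

Lemma cq_proj_inv (x : G) : cq_inv (cq_proj x) = cq_proj x^-1%g.
Proof.
apply/eqP; rewrite eq_sym; apply/cq_projP.
have [->|->] := cq_repr x; [by left|right].
have zV : (z^-1 = z)%g by apply: (mulgI z); rewrite mulgV zz.
by rewrite invgM zV zC.
Qed.

Lemma cq_projS (p : central_quot) : exists x, p = cq_proj x.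
Proof. by exists (repr p); rewrite /cq_proj reprK. Qed.

Lemma cq_mulA : associative cq_mul.
Proof.
move=> p q r; have [x ->] := cq_projS p; have [y ->] := cq_projS q.
have [w ->] := cq_projS r.
by rewrite !cq_proj_mul mulgA.
Qed.

Lemma cq_mul1 : left_id (cq_proj 1%g) cq_mul.
Proof. by move=> p; have [x ->] := cq_projS p; rewrite cq_proj_mul mul1g. Qed.

Lemma cq_mulr1 : right_id (cq_proj 1%g) cq_mul.
Proof. by move=> p; have [x ->] := cq_projS p; rewrite cq_proj_mul mulg1. Qed.

Lemma cq_mulV : left_inverse (cq_proj 1%g) cq_inv cq_mul.
Proof.
by move=> p; have [x ->] := cq_projS p; rewrite cq_proj_inv cq_proj_mul mulVg.
Qed.

Lemma cq_mulrV : right_inverse (cq_proj 1%g) cq_inv cq_mul.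
Proof.
by move=> p; have [x ->] := cq_projS p; rewrite cq_proj_inv cq_proj_mul mulgV.
Qed.

HB.instance Definition _ :=
  isGroup.Build central_quot cq_mulA cq_mul1 cq_mulr1 cq_mulV cq_mulrV.

End CentralInvolutionQuotient.

Section SpinC.
Context (R : realType).
Local Notation C := R[i].
Local Open Scope sesquilinear_scope.

Definition S1 : Type := {c : C | `|c| == 1}.
HB.instance Definition _ := Choice.on S1.
HB.instance Definition _ := SubType.on S1.

Definition SU2 : Type := {U : 'M[C]_2 | (U \is unitarymx) && (\det U == 1)}.
HB.instance Definition _ := Choice.on SU2.
HB.instance Definition _ := SubType.on SU2.

Lemma S1_normM (u v : S1) : `|val u * val v| == 1.
Proof. by rewrite normrM (eqP (valP u)) (eqP (valP v)) mulr1. Qed.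
Lemma S1_normV (u : S1) : `|(val u)^-1| == 1.
Proof. by rewrite normfV (eqP (valP u)) invr1. Qed.
Lemma S1_norm1 : `|1 : C| == 1. Proof. by rewrite normr1. Qed.
Lemma S1_normN1 : `|- 1 : C| == 1. Proof. by rewrite normrN normr1. Qed.
Lemma S1_neq0 (u : S1) : val u != 0.
Proof. by rewrite -normr_eq0 (eqP (valP u)) oner_eq0. Qed.

Definition S1_mul (u v : S1) : S1 := exist _ (val u * val v) (S1_normM u v).
Definition S1_inv (u : S1) : S1 := exist _ (val u)^-1 (S1_normV u).
Definition S1_one : S1 := exist _ 1 S1_norm1.
Definition S1_N1 : S1 := exist _ (- 1) S1_normN1.

Lemma S1_mulA : associative S1_mul.
Proof. by move=> u v w; apply: val_inj; rewrite /= mulrA. Qed.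
Lemma S1_mul1 : left_id S1_one S1_mul.
Proof. by move=> u; apply: val_inj; rewrite /= mul1r. Qed.
Lemma S1_mulr1 : right_id S1_one S1_mul.
Proof. by move=> u; apply: val_inj; rewrite /= mulr1. Qed.
Lemma S1_mulV : left_inverse S1_one S1_inv S1_mul.
Proof. by move=> u; apply: val_inj; rewrite /= mulVf ?S1_neq0. Qed.
Lemma S1_mulrV : right_inverse S1_one S1_inv S1_mul.
Proof. by move=> u; apply: val_inj; rewrite /= mulfV ?S1_neq0. Qed.

HB.instance Definition _ :=
  isGroup.Build S1 S1_mulA S1_mul1 S1_mulr1 S1_mulV S1_mulrV.

Lemma SU2_unitary (U : SU2) : val U \is unitarymx.
Proof. by have /andP[] := valP U. Qed.
Lemma SU2_det (U : SU2) : \det (val U) = 1.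
Proof. by have /andP[_ /eqP] := valP U. Qed.
Lemma SU2_mulVmx (U : SU2) : (val U)^t* *m val U = 1%:M.
Proof. by apply/mulmx1C/unitarymxP/SU2_unitary. Qed.

Lemma SU2_mul_subproof (U V : SU2) :
  (val U *m val V \is unitarymx) && (\det (val U *m val V) == 1).
Proof. by rewrite mul_unitarymx ?SU2_unitary// det_mulmx !SU2_det mulr1 eqxx. Qed.
Lemma SU2_inv_subproof (U : SU2) :
  ((val U)^t* \is unitarymx) && (\det ((val U)^t*) == 1).
Proof.
by rewrite trmxC_unitary SU2_unitary /= det_map_mx det_tr SU2_det rmorph1.
Qed.
Lemma SU2_one_subproof :
  ((1%:M : 'M[C]_2) \is unitarymx) && (\det (1%:M : 'M[C]_2) == 1).
Proof.
rewrite det1 eqxx andbT; apply/unitarymxP.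
by rewrite tr_scalar_mx map_scalar_mx /= conjC1 mulmx1.
Qed.
Lemma SU2_N1_subproof :
  ((- 1%:M : 'M[C]_2) \is unitarymx) && (\det (- 1%:M : 'M[C]_2) == 1).
Proof.
rewrite -scaleN1r scalemx1 det_scalar sqrrN expr1n eqxx andbT.
apply/unitarymxP.
by rewrite tr_scalar_mx map_scalar_mx /= conjCN1 -scalar_mxM mulrNN mulr1.
Qed.

Definition SU2_mul (U V : SU2) : SU2 := exist _ (val U *m val V) (SU2_mul_subproof U V).
Definition SU2_inv (U : SU2) : SU2 := exist _ ((val U)^t*) (SU2_inv_subproof U).
Definition SU2_one : SU2 := exist _ 1%:M SU2_one_subproof.
Definition SU2_N1 : SU2 := exist _ (- 1%:M) SU2_N1_subproof.

Lemma SU2_mulA : associative SU2_mul.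
Proof. by move=> u v w; apply: val_inj; rewrite /= mulmxA. Qed.
Lemma SU2_mul1 : left_id SU2_one SU2_mul.
Proof. by move=> u; apply: val_inj; rewrite /= mul1mx. Qed.
Lemma SU2_mulr1 : right_id SU2_one SU2_mul.
Proof. by move=> u; apply: val_inj; rewrite /= mulmx1. Qed.
Lemma SU2_mulV : left_inverse SU2_one SU2_inv SU2_mul.
Proof. by move=> u; apply: val_inj; rewrite /= SU2_mulVmx. Qed.
Lemma SU2_mulrV : right_inverse SU2_one SU2_inv SU2_mul.
Proof.
by move=> u; apply: val_inj; rewrite /=; apply/unitarymxP/SU2_unitary.
Qed.

HB.instance Definition _ :=
  isGroup.Build SU2 SU2_mulA SU2_mul1 SU2_mulr1 SU2_mulV SU2_mulrV.

Definition minus_one : S1 * SU2 := (S1_N1, SU2_N1).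

Lemma minus_one_central_involution :
  (minus_one * minus_one = 1)%g /\
  forall x : S1 * SU2, (minus_one * x = x * minus_one)%g.
Proof.
split=> [|[u U]]; congr pair; apply: val_inj => /=.
- by rewrite mulrNN mulr1.
- by rewrite mulNmx mulmxN opprK mulmx1.
- by rewrite mulrC.
- by rewrite mulNmx mulmxN mul1mx mulmx1.
Qed.

(* S^1 x_{Z_2} SU(2), under the identification Spin(3) = SU(2) *)
Definition Spinc3 : Type := central_quot minus_one_central_involution.
HB.instance Definition _ := Group.on Spinc3.

Definition spinc_class (u : S1) (U : SU2) : Spinc3 :=
  cq_proj minus_one_central_involution (u, U).

End SpinC.
Arguments spinc_class {R}.

(* Main.v *)
(* Write W = C^2 \ {0}. Since W is simply connected, an automorphism phi of W / <f> lifts to a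
   holomorphic F : W -> W, and F (alpha v) = alpha^k F v for some integer k. Comparing with a
   lift of the inverse of phi gives k = 1 or k = -1. By compactness of the fundamental annulus,
   |F v| <= M |v|^k, so on a complex line z |-> p + z q missing the origin F is an entire
   function of at most linear growth, hence affine: F (p + z q) = F p + z c. Rescaling by powers
   of alpha and letting z = alpha^-n go to infinity, continuity of F at q yields c = F q if
   k = 1, so that F is linear, and F p = 0 if k = -1, which is absurd. A lift that is linear
   commutes with s_f up to a deck transformation; squaring shows that it commutes with J, so it
   is a positive multiple r U of an element of SU(2). Finally r = |alpha|^t, and the pairs
   (e^(i pi t), U) and (e^(i pi (t + 1)), - U) induce the same map because alpha = - |alpha|.

   The Liouville step integrates a combination of difference quotients of F along large squares;
   these are continuous and differentiable off one point, so Goursat's bisection suffices. *)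
From mathcomp Require Import all_boot all_order all_algebra.
From mathcomp Require Import complex ring lra zify.
From mathcomp Require Import all_classical all_reals all_analysis.
Require Import Defs.
Import Order.TTheory GRing.Theory Num.Theory.
Import numFieldNormedType.Exports.
Import Normc.

Set Implicit Arguments.
Unset Strict Implicit.
Unset Printing Implicit Defensive.

Local Open Scope classical_set_scope.
Local Open Scope ring_scope.
Local Open Scope complex_scope.

Local Notation Re := complex.Re.
Local Notation Im := complex.Im.

(** * Goursat and Liouville *)

Section OrientedIntegral.
Context {R : realType}.
Implicit Types f g F : R -> R.

(** The covering of the Hopf surface is controlled by one real function:
    [vlevel v = ln |v| / ln |alpha|] increases by n under v |-> alpha^n v, so it descends to a map
    to R/Z, and within a fibre it identifies the point. A map to the Hopf surface therefore lifts as
    soon as the level of its values, an R/Z-valued function, lifts to R; simple connectedness of W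
    is proved in exactly that form, by gluing along segments.

    A lift F is known on W only and is never extended over the origin. A line z |-> p + z q with p,
    q independent stays in W, so one-variable results apply to F there, and linearity is recovered
    from these lines alone. No Cauchy formula or power series enters: that an entire g of linear
    growth is affine is tested on the points 0, 1, x, and the vanishing of one boundary integral is
    contradicted by its sign. *)

Lemma is_derive_mean F f (a b : R) : (forall x : R, is_derive x 1 F (f x)) -> a <= b ->
  exists2 c, a <= c <= b & F b - F a = f c * (b - a).
Proof.
move=> dF ab; have [|c cab ->] := MVT_segment ab (fun x _ => dF x).
  apply: continuous_subspaceT => x; apply/differentiable_continuous/derivable1_diffP.
  by case: (dF x).
by exists c => //; move: cab; rewrite in_itv.
Qed.

(** The fundamental theorem of calculus gives a derivative only inside a bounded interval. The
    primitives [G N], normalised to vanish at 0, agree where both apply, and are patched by letting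
    [N] follow [x]. *)
Lemma continuous_has_primitive f : continuous f ->
  exists F, forall x : R, is_derive x 1 F (f x).
Proof.
move=> cf.
pose mu := @lebesgue_measure R.
pose I (N x : R) := (\int[mu]_(t in `[- N, x]) f t)%R.
have dI (N x : R) : - N < x -> is_derive x 1 (I N) (f x).
  move=> Nx; have xx1 : x < x + 1 by rewrite ltrDl.
  have fi : mu.-integrable `[- N, x + 1] (EFin \o f).
    apply: continuous_compact_integrable; first exact: segment_compact.
    exact: continuous_subspaceT.
  have [] := continuous_FTC1_closed xx1 fi Nx (cf x).
  by move=> d1 d2; apply: DeriveDef; [exact: d1|rewrite -derive1E].
pose G N x := I N x - I N 0.
have dG (N x : R) : - N < x -> is_derive x 1 (G N) (f x).
  move=> /dI h; rewrite /G -[f x]subr0; exact: is_deriveB.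
have GG (N M x : R) : `|x| < N -> `|x| < M -> G N x = G M x.
  move=> xN xM.
  have N0 : 0 < N by exact: le_lt_trans xN.
  have M0 : 0 < M by exact: le_lt_trans xM.
  move: xN xM; rewrite !ltr_norml => /andP[xN1 xN2] /andP[xM1 xM2].
  have d0 (y : R) : - N < y -> - M < y -> is_derive y 1 (G N - G M) 0.
    by move=> yN yM; rewrite -(subrr (f y)); apply: is_deriveB; exact: dG.
  have Z (a b : R) : - N < a -> - M < a -> a <= b -> (G N - G M) a = (G N - G M) b.
    move=> aN aM ab.
    have [||c _ h] := @MVT_segment _ (G N - G M) (fun=> 0) a b ab.
    - move=> y; rewrite in_itv/= => /andP[ay _].
      by apply: d0; exact: lt_trans ay.
    - apply: derivable_within_continuous => y; rewrite in_itv/= => /andP[ay _].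
      by have [] := d0 y (lt_le_trans aN ay) (lt_le_trans aM ay).
    - by apply/eqP; rewrite eq_sym -subr_eq0 h mul0r.
  have e0 : (G N - G M) 0 = 0 by rewrite /G !fctE/= !subrr.
  suff : (G N - G M) x = 0 by rewrite !fctE => /eqP; rewrite subr_eq0 => /eqP.
  case: (leP x 0) => x0; first by rewrite (Z x 0).
  by rewrite -(Z 0 x) ?e0 ?oppr_lt0// ltW.
exists (fun x => G (`|x| + 1) x) => x.
have xx : - (`|x| + 2) < x.
  have := ler_norm (- x); rewrite normrN; lra.
apply: (@near_eq_is_derive _ _ _ (G (`|x| + 2)) _ _ _ _ _ (dG _ _ xx)).
near=> y; apply: GG; last by rewrite ltrDl.
have : `|x - y| < 1 by near: y; apply: cvgr_dist_lt => //; exact: cvg_id.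
move=> h; have := ler_normD (y - x) x; rewrite subrK distrC => h'.
apply: le_lt_trans h' _; lra.
Unshelve. all: by end_near. Qed.

Definition primitive f : R -> R :=
  xget (fun=> 0) [set F | forall x : R, is_derive x 1 F (f x)].

(** A difference of values of one chosen primitive: subdividing an interval becomes a ring identity,
    free of integrability conditions. *)
Definition oint f (a b : R) : R := primitive f b - primitive f a.

Lemma primitiveP f : continuous f -> forall x : R, is_derive x 1 (primitive f) (f x).
Proof.
move=> /continuous_has_primitive [F hF]; rewrite /primitive.
by case: xgetP => [y _|/(_ F)//].
Qed.

Lemma ointE f F a b : (forall x : R, is_derive x 1 F (f x)) -> oint f a b = F b - F a.
Proof.
move=> dF; rewrite /oint; set P := primitive f.
have dP (x : R) : is_derive x 1 P (f x).
  by rewrite /P /primitive; case: xgetP => [y _|/(_ F)//].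
have d0 (x : R) : is_derive x 1 (P - F) 0.
  by rewrite -(subrr (f x)); exact: is_deriveB.
have Z : (P - F) a = (P - F) b by exact: is_derive_0_is_cst.
by move: Z; rewrite !fctE => Z; lra.
Qed.

Lemma ointD f g a b : continuous f -> continuous g ->
  oint (fun x => f x + g x) a b = oint f a b + oint g a b.
Proof.
move=> cf cg.
have d (x : R) : is_derive x 1 (primitive f + primitive g) (f x + g x).
  by apply: is_deriveD; exact: primitiveP.
rewrite (ointE _ _ d) /oint !fctE; lra.
Qed.

Lemma ointN f a b : continuous f -> oint (fun x => - f x) a b = - oint f a b.
Proof.
move=> cf; have d (x : R) : is_derive x 1 (- primitive f) (- f x).
  by apply: is_deriveN; exact: primitiveP.
rewrite (ointE _ _ d) /oint !fctE; lra.
Qed.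

Lemma oint_near f (a b c M : R) : continuous f -> a <= b ->
  (forall x, a <= x <= b -> `|f x - c| <= M) ->
  `|oint f a b - c * (b - a)| <= M * (b - a).
Proof.
move=> cf ab h; have [t tab e] := is_derive_mean (primitiveP cf) ab.
rewrite /oint e -mulrBl normrM (ger0_norm (_ : 0 <= b - a)) ?subr_ge0//.
by rewrite ler_wpM2r ?subr_ge0// h.
Qed.

Lemma oint_le f (a b c : R) : continuous f -> a <= b ->
  (forall x, a <= x <= b -> f x <= c) -> oint f a b <= c * (b - a).
Proof.
move=> cf ab h; have [t tab e] := is_derive_mean (primitiveP cf) ab.
by rewrite /oint e ler_wpM2r ?subr_ge0// h.
Qed.

End OrientedIntegral.

(** * The modulus of a complex number as a real number *)

Section ComplexNorm.
Context {R : realType}.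
Implicit Types z w : R[i].

Lemma normcC z : `|z| = (normc z)%:C.
Proof. by case: z. Qed.

Lemma normc_ge0 z : 0 <= normc z.
Proof. by rewrite -ler0c -normcC. Qed.

Lemma normc_eq0 z : (normc z == 0) = (z == 0).
Proof. by apply/eqP/eqP => [/eq0_normc//|->]; exact: normc0. Qed.

Lemma normc_gt0 z : (0 < normc z) = (z != 0).
Proof. by rewrite lt0r normc_ge0 andbT normc_eq0. Qed.

Lemma abs_Re_le z : `|Re z| <= normc z.
Proof. by have := normc_ge_Re z; rewrite normcC lecR. Qed.

Lemma abs_Im_le z : `|Im z| <= normc z.
Proof.
case: z => x y /=; rewrite -sqrtr_sqr; apply: ler_wsqrtr.
by rewrite lerDr sqr_ge0.
Qed.

Lemma normc_leD z w : normc (z + w) <= normc z + normc w.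
Proof. by have := ler_normD z w; rewrite !normcC -rmorphD lecR. Qed.

Lemma normcB z w : normc (z - w) = normc (w - z).
Proof. by apply: complexI; rewrite -!normcC distrC. Qed.

Lemma normc_le_Re_Im z : normc z <= `|Re z| + `|Im z|.
Proof.
case: z => x y; rewrite [in leLHS](_ : x +i* y = x%:C + (0 +i* y)).
  apply: le_trans (normc_leD _ _) _.
  by rewrite /= expr0n/= addr0 add0r !sqrtr_sqr.
by apply/eqP; rewrite eq_complex/= addr0 add0r !eqxx.
Qed.

End ComplexNorm.

(** * Boundary integrals over rectangles *)

Section RectangleIntegral.
Context {R : realType}.
Implicit Types (f g : R[i] -> R[i]) (r : (R * R) * (R * R)).

Lemma cvg_normcP f z : {for z, continuous f} ->
  forall e : R, 0 < e -> exists2 d : R, 0 < d &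
    forall w, normc (w - z) < d -> normc (f w - f z) < e.
Proof.
move=> cf e e0.
have e0' : 0 < e%:C by rewrite ltcR.
move/cvgr_dist_lt: cf => /(_ _ e0') /nbhs_ballP[d /= d0 h].
have dE : (Re d)%:C = d by apply: RRe_real; exact: gtr0_real.
exists (Re d) => [|w wz]; first by rewrite -ltcR dE.
have : ball z d w by rewrite /ball/= distrC normcC -dE ltcR.
by move=> /h; rewrite /= normcC ltcR normcB.
Qed.

Lemma normc_line_continuous (f : R[i] -> R[i]) (g : R -> R[i]) (p : R[i] -> R) :
  continuous f ->
  (forall s t, normc (g s - g t) <= `|s - t|) ->
  (forall z w, `|p z - p w| <= normc (z - w)) ->
  continuous (fun t => p (f (g t))).
Proof.
move=> cf gl pl t; apply/cvgrPdist_lt => e e0.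
have [d d0 h] := cvg_normcP (cf (g t)) e0.
near=> s; apply: le_lt_trans (pl _ _) _; rewrite normcB; apply: h.
apply: le_lt_trans (gl _ _) _; rewrite distrC.
by near: s; apply: cvgr_dist_lt => //; exact: cvg_id.
Unshelve. all: by end_near. Qed.

Lemma continuous_Im_hline f (y : R) : continuous f ->
  continuous (fun x => Im (f (x +i* y))).
Proof.
move=> cf; apply: (@normc_line_continuous f (fun x => x +i* y)) => // [s t|z w].
  by apply: le_trans (normc_le_Re_Im _) _; rewrite /= subrr normr0 addr0.
by rewrite -raddfB; exact: abs_Im_le.
Qed.

Lemma continuous_Re_vline f (x : R) : continuous f ->
  continuous (fun y => Re (f (x +i* y))).
Proof.
move=> cf; apply: (@normc_line_continuous f (fun y => x +i* y)) => // [s t|z w].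
  by apply: le_trans (normc_le_Re_Im _) _; rewrite /= subrr normr0 add0r.
by rewrite -raddfB; exact: abs_Re_le.
Qed.

(* The imaginary part of the integral of [f] along the boundary of a rectangle. *)
Definition loop f (x1 x2 y1 y2 : R) : R :=
  oint (fun x => Im (f (x +i* y1))) x1 x2 + oint (fun y => Re (f (x2 +i* y))) y1 y2
  - oint (fun x => Im (f (x +i* y2))) x1 x2 - oint (fun y => Re (f (x1 +i* y))) y1 y2.

Lemma loop_hcut f (c x1 x2 y1 y2 : R) :
  loop f x1 x2 y1 y2 = loop f x1 c y1 y2 + loop f c x2 y1 y2.
Proof. by rewrite /loop /oint; ring. Qed.

Lemma loop_vcut f (c x1 x2 y1 y2 : R) :
  loop f x1 x2 y1 y2 = loop f x1 x2 y1 c + loop f x1 x2 c y2.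
Proof. by rewrite /loop /oint; ring. Qed.

Lemma loopD f g x1 x2 y1 y2 : continuous f -> continuous g ->
  loop (fun z => f z + g z) x1 x2 y1 y2 = loop f x1 x2 y1 y2 + loop g x1 x2 y1 y2.
Proof.
move=> cf cg; rewrite /loop.
have ID y : (fun x => Im (f (x +i* y) + g (x +i* y)))
    = (fun x => Im (f (x +i* y)) + Im (g (x +i* y))) by apply/funext => x; rewrite raddfD.
have RD x : (fun y => Re (f (x +i* y) + g (x +i* y)))
    = (fun y => Re (f (x +i* y)) + Re (g (x +i* y))) by apply/funext => y; rewrite raddfD.
rewrite !ID !RD !ointD; first ring.
all: by [exact: continuous_Im_hline|exact: continuous_Re_vline].
Qed.

(* Pairing opposite sides, the constant part of [f - c] along them cancels. *)
Lemma loop_near f (c : R) (x1 x2 y1 y2 M : R) : continuous f ->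
  x1 <= x2 -> y1 <= y2 ->
  (forall x, x1 <= x <= x2 ->
     `|Im (f (x +i* y1)) - Im (f (x +i* y2)) - c * (y1 - y2)| <= M) ->
  (forall y, y1 <= y <= y2 ->
     `|Re (f (x2 +i* y)) - Re (f (x1 +i* y)) - c * (x2 - x1)| <= M) ->
  `|loop f x1 x2 y1 y2| <= M * (x2 - x1) + M * (y2 - y1).
Proof.
move=> cf x12 y12 hI hR.
have cI y := @continuous_Im_hline f y cf; have cR x := @continuous_Re_vline f x cf.
have cI' : continuous (fun x => Im (f (x +i* y1)) - Im (f (x +i* y2))).
  by move=> x; apply: cvgB; exact: cI.
have cR' : continuous (fun y => Re (f (x2 +i* y)) - Re (f (x1 +i* y))).
  by move=> x; apply: cvgB; exact: cR.
have nI y : continuous (fun x => - Im (f (x +i* y))) by move=> x; apply: cvgN; exact: cI.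
have nR x : continuous (fun y => - Re (f (x +i* y))) by move=> y; apply: cvgN; exact: cR.
have := oint_near cI' x12 hI; have := oint_near cR' y12 hR.
rewrite !ointD// !ointN// => h1 h2.
have -> : loop f x1 x2 y1 y2 =
  (oint (fun y => Re (f (x2 +i* y))) y1 y2 - oint (fun y => Re (f (x1 +i* y))) y1 y2
   - c * (x2 - x1) * (y2 - y1)) +
  (oint (fun x => Im (f (x +i* y1))) x1 x2 - oint (fun x => Im (f (x +i* y2))) x1 x2
   - c * (y1 - y2) * (x2 - x1)) by rewrite /loop; ring.
by rewrite addrC [leRHS]addrC; apply: le_trans (ler_normD _ _) _; rewrite addrC lerD.
Qed.

Definition cdiff f (z : R[i]) := exists l : R[i], forall e : R, 0 < e ->
  exists2 d : R, 0 < d & forall w, normc (w - z) < d ->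
    normc (f w - f z - l * (w - z)) <= e * normc (w - z).

(** Here [c = Re l] in [loop_near]: the linear part of f makes Im differ by [Re l * (y1 - y2)]
    between the horizontal sides, and Re by [Re l * (x2 - x1)] between the vertical ones. The
    constant 8 pays for points within [2 * D] of z, for the two sides of a pair, and for the two
    pairs. *)
Lemma loop_cdiff f (z : R[i]) (e : R) : continuous f -> cdiff f z -> 0 < e ->
  exists2 d : R, 0 < d & forall x1 x2 y1 y2 D : R, D < d ->
    x1 <= Re z <= x2 -> y1 <= Im z <= y2 -> x2 - x1 <= D -> y2 - y1 <= D ->
    `|loop f x1 x2 y1 y2| <= e * D ^+ 2.
Proof.
case: z => x0 y0 cf [l hl] e0.
have e80 : 0 < e / 8 by lra.
have [d d0 h] := hl _ e80; exists (d / 2) => [|x1 x2 y1 y2 D Dd]; first lra.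
move=> /= /andP[xa xb] /andP[ya yb] xD yD.
have near x y : x1 <= x <= x2 -> y1 <= y <= y2 ->
    normc (f (x +i* y) - f (x0 +i* y0) - l * ((x - x0) +i* (y - y0))) <= e / 8 * (2 * D).
  move=> /andP[xc xd] /andP[yc yd].
  have nD : normc ((x - x0) +i* (y - y0)) <= 2 * D.
    apply: le_trans (normc_le_Re_Im _) _ => /=.
    have : `|x - x0| <= D by rewrite ler_norml; lra.
    have : `|y - y0| <= D by rewrite ler_norml; lra.
    lra.
  have := h (x +i* y); rewrite (_ : _ +i* _ - _ = (x - x0) +i* (y - y0))//.
  move=> h'; apply: le_trans (h' _) _; first by apply: le_lt_trans nD _; lra.
  by rewrite ler_wpM2l// ltW.
have x12 : x1 <= x2 by lra.
have y12 : y1 <= y2 by lra.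
have D0 : 0 <= D by lra.
have -> : e * D ^+ 2 = e / 2 * D * D + e / 2 * D * D by rewrite expr2; field.
apply: le_trans (@loop_near f (Re l) x1 x2 y1 y2 (e / 2 * D) cf x12 y12 _ _) _; last first.
- by apply: lerD; apply: ler_wpM2l => //; rewrite mulr_ge0//; lra.
- move=> y yy.
  have [] := (near x2 y, near x1 y); rewrite !lexx x12/= => /(_ isT yy) h1 /(_ isT yy) h2.
  have := le_trans (abs_Re_le _) h1; have := le_trans (abs_Re_le _) h2.
  move: (f _) (f _) (f _) l {h h1 h2 near hl} => [a1 b1] [a2 b2] [a3 b3] [l1 l2] /=.
  rewrite !ler_norml; lra.
- move=> x xx.
  have [] := (near x y1, near x y2); rewrite !lexx y12/= => /(_ xx isT) h1 /(_ xx isT) h2.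
  have := le_trans (abs_Im_le _) h1; have := le_trans (abs_Im_le _) h2.
  move: (f _) (f _) (f _) l {h h1 h2 near hl} => [a1 b1] [a2 b2] [a3 b3] [l1 l2] /=.
  rewrite !ler_norml; lra.
Qed.

End RectangleIntegral.

(** * Goursat's theorem, with one exceptional point *)

Section Goursat.
Context {R : realType}.
Implicit Types (f g : R[i] -> R[i]) (r : (R * R) * (R * R)).

Lemma nested_intervals (a b : R ^nat) :
  (forall n, a n <= a n.+1) -> (forall n, b n.+1 <= b n) -> (forall n, a n <= b n) ->
  exists c, forall n, a n <= c <= b n.
Proof.
move=> ia db ab.
have am n m : (n <= m)%N -> a n <= a m.
  by move=> /subnK <-; elim: (m - n)%N => //= k; rewrite addSn => h; exact: le_trans (ia _).
have bm n m : (n <= m)%N -> b m <= b n.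
  by move=> /subnK <-; elim: (m - n)%N => //= k; rewrite addSn => h; exact: le_trans h.
have anb n m : a n <= b m.
  by apply: le_trans (am n (maxn n m) _) (le_trans (ab _) (bm m _ _)); rewrite ?leq_maxl ?leq_maxr.
exists (sup (range a)) => n; apply/andP; split.
  apply: ub_le_sup; last by exists n.
  by exists (b 0%N) => _ [m _ <-].
by apply: ge_sup; [exists (a 0%N), 0%N|move=> _ [m _ <-]].
Qed.

Lemma exp2V_small (D d : R) : 0 < d -> exists n : nat, D / 2 ^+ n < d.
Proof.
move=> d0; exists (Num.truncn (D / d)).+1.
rewrite ltr_pdivrMr ?exprn_gt0// mulrC -ltr_pdivrMr//.
apply: lt_trans (truncnS_gt _) _.
by rewrite -natrX ltr_nat ltn_expl.
Qed.

Let L f r := loop f r.1.1 r.1.2 r.2.1 r.2.2.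
Let valid r := r.1.1 <= r.1.2 /\ r.2.1 <= r.2.2.

(** Shared sides of the four quarters cancel, so the quarter loops add up to the whole and one of
    them carries at least a quarter of it. *)
Lemma loop_bisect f r : valid r -> exists r',
  [/\ valid r',
      r.1.1 <= r'.1.1 /\ r'.1.2 <= r.1.2, r.2.1 <= r'.2.1 /\ r'.2.2 <= r.2.2,
      r'.1.2 - r'.1.1 = (r.1.2 - r.1.1) / 2 /\ r'.2.2 - r'.2.1 = (r.2.2 - r.2.1) / 2 &
      `|L f r| <= 4 * `|L f r'|].
Proof.
case: r => [[a b] [c d]] [/= ab cd].
set m := (a + b) / 2; set n := (c + d) / 2.
have := loop_hcut f m a b c d; rewrite !(loop_vcut f n _ _ c d) => e.
have mE : 2 * m = a + b by rewrite /m; field.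
have nE : 2 * n = c + d by rewrite /n; field.
case: (lerP `|loop f a b c d| (4 * `|loop f a m c n|)) => [h|h1].
  exists ((a, m), (c, n)); rewrite /valid /L/=; split => //; lra.
case: (lerP `|loop f a b c d| (4 * `|loop f m b c n|)) => [h|h2].
  exists ((m, b), (c, n)); rewrite /valid /L/=; split => //; lra.
case: (lerP `|loop f a b c d| (4 * `|loop f a m n d|)) => [h|h3].
  exists ((a, m), (n, d)); rewrite /valid /L/=; split => //; lra.
exists ((m, b), (n, d)); rewrite /valid /L/=; split => //; try lra.
have := ler_normD (loop f a m c n + loop f a m n d) (loop f m b c n + loop f m b n d).
rewrite -(loop_vcut f n m b) -(loop_vcut f n a m) -loop_hcut !(loop_vcut f n _ _ c d).
have := ler_normD (loop f a m c n) (loop f a m n d).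
have := ler_normD (loop f m b c n) (loop f m b n d).
move: h1 h2 h3; rewrite (loop_vcut f n a b) ; lra.
Qed.


(** The quarters shrink to a point at which f is differentiable; there the n-th loop is at most a
    constant times [e / 4 ^ n], which cancels the factor [4 ^ n] lost in n bisections. *)
Theorem goursat f (x1 x2 y1 y2 : R) : continuous f -> x1 <= x2 -> y1 <= y2 ->
  (forall z, x1 <= Re z <= x2 -> y1 <= Im z <= y2 -> cdiff f z) ->
  loop f x1 x2 y1 y2 = 0.
Proof.
move=> cf x12 y12 df.
have /choice[next nextP] : forall r, exists r', valid r -> [/\ valid r',
      r.1.1 <= r'.1.1 /\ r'.1.2 <= r.1.2, r.2.1 <= r'.2.1 /\ r'.2.2 <= r.2.2,
      r'.1.2 - r'.1.1 = (r.1.2 - r.1.1) / 2 /\ r'.2.2 - r'.2.1 = (r.2.2 - r.2.1) / 2 &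
      `|L f r| <= 4 * `|L f r'|].
  move=> r; have [/(loop_bisect f)[r' h]|h] := pselect (valid r); first by exists r'.
  by exists r => /h.
pose s n := iter n next ((x1, x2), (y1, y2)).
have vs n : valid (s n) by elim: n => [//|n /nextP[]].
have [cx hx] : exists c, forall n, (s n).1.1 <= c <= (s n).1.2.
  by apply: nested_intervals => n; have [v [? ?] [? ?] _ _] := nextP _ (vs n); case: (vs n).
have [cy hy] : exists c, forall n, (s n).2.1 <= c <= (s n).2.2.
  by apply: nested_intervals => n; have [v [? ?] [? ?] _ _] := nextP _ (vs n); case: (vs n).
have wx n : (s n).1.2 - (s n).1.1 = (x2 - x1) / 2 ^+ n.
  elim: n => [|n IH]; first by rewrite divr1.
  have [_ _ _ [-> _] _] := nextP _ (vs n); rewrite IH exprS; field.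
  by rewrite expf_neq0.
have wy n : (s n).2.2 - (s n).2.1 = (y2 - y1) / 2 ^+ n.
  elim: n => [|n IH]; first by rewrite divr1.
  have [_ _ _ [_ ->] _] := nextP _ (vs n); rewrite IH exprS; field.
  by rewrite expf_neq0.
have Ls n : `|loop f x1 x2 y1 y2| <= 4 ^+ n * `|L f (s n)|.
  elim: n => [|n IH]; first by rewrite mul1r.
  have [_ _ _ _ h] := nextP _ (vs n); apply: le_trans IH _.
  by rewrite exprSr -mulrA ler_wpM2l// exprn_ge0.
have hd e := @loop_cdiff _ f (cx +i* cy) e cf (df (cx +i* cy) (hx 0%N) (hy 0%N)).
set D := (x2 - x1) + (y2 - y1).
apply/eqP; rewrite -normr_le0; apply/ler_addgt0Pl => e e0; rewrite addr0.
(* The [+ 1] keeps the denominator positive for a rectangle reduced to a point. *)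
have e1 : 0 < e / (D ^+ 2 + 1) by rewrite divr_gt0// ltr_wpDl// sqr_ge0.
have [d d0 hd'] := hd _ e1; have [n hn] := exp2V_small D d0.
have n2 : 0 < 2 ^+ n :> R by rewrite exprn_gt0.
have := hd' (s n).1.1 (s n).1.2 (s n).2.1 (s n).2.2 _ hn (hx n) (hy n).
rewrite wx wy !ler_pM2r ?invr_gt0// => h.
apply: le_trans (Ls n) _.
apply: le_trans (_ : 4 ^+ n * (e / (D ^+ 2 + 1) * (D / 2 ^+ n) ^+ 2) <= _).
  rewrite ler_wpM2l ?exprn_ge0//; apply: h; rewrite /D; lra.
have -> : 4 ^+ n = (2 ^+ n) ^+ 2 :> R by rewrite -exprM mulnC exprM; congr (_ ^+ n); ring.
have -> : (2 ^+ n) ^+ 2 * (e / (D ^+ 2 + 1) * (D / 2 ^+ n) ^+ 2) = e * (D ^+ 2 / (D ^+ 2 + 1)).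
  by field; rewrite expf_neq0//= gt_eqF// ltr_wpDl// sqr_ge0.
have D1 : 0 < D ^+ 2 + 1 by rewrite ltr_wpDl// sqr_ge0.
by rewrite -[leRHS]mulr1 ler_pM2l// ler_pdivrMr// mul1r lerDl.
Qed.

(* Cutting along lines through [a +- d] leaves a square of side [2 d] around [a], on
   which continuity alone makes the boundary integral O(d). *)
Lemma goursat_puncture f (a : R[i]) (x1 x2 y1 y2 : R) : continuous f ->
  x1 < Re a < x2 -> y1 < Im a < y2 ->
  (forall z, z != a -> cdiff f z) ->
  loop f x1 x2 y1 y2 = 0.
Proof.
case: a => p q cf /= /andP[xp px] /andP[yq qy] df.
have [d0 d00 near_a] := cvg_normcP (cf (p +i* q)) ltr01.
set M := normc (f (p +i* q)) + 1.
have M0 : 0 <= M by rewrite addr_ge0 ?normc_ge0.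
have off x3 x4 y3 y4 : x3 <= x4 -> y3 <= y4 ->
    ~~ ((x3 <= p <= x4) && (y3 <= q <= y4)) -> loop f x3 x4 y3 y4 = 0.
  move=> x34 y34 h; apply: goursat => // -[x y]/= hx hy; apply: df.
  by apply: contra h; rewrite eq_complex/= => /andP[/eqP<- /eqP<-]; rewrite hx hy.
have small d : 0 < d -> d < d0 / 2 -> d < p - x1 -> d < x2 - p -> d < q - y1 -> d < y2 - q ->
    `|loop f x1 x2 y1 y2| <= 8 * M * d.
  move=> dgt dd d1 d2 d3 d4.
  have b1 : loop f x1 x2 y1 (q - d) = 0.
    by apply: off; [lra|lra|apply/negP => /andP[_ /andP[]]; lra].
  have b2 : loop f x1 x2 (q + d) y2 = 0.
    by apply: off; [lra|lra|apply/negP => /andP[_ /andP[]]; lra].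
  have b3 : loop f x1 (p - d) (q - d) (q + d) = 0.
    by apply: off; [lra|lra|apply/negP => /andP[/andP[]]; lra].
  have b4 : loop f (p + d) x2 (q - d) (q + d) = 0.
    by apply: off; [lra|lra|apply/negP => /andP[/andP[]]; lra].
  rewrite (loop_vcut f (q - d)) (loop_vcut f (q + d) _ _ (q - d)) b1 b2 add0r addr0.
  rewrite (loop_hcut f (p - d)) (loop_hcut f (p + d) (p - d)) b3 b4 add0r addr0.
  have near x y : p - d <= x <= p + d -> q - d <= y <= q + d -> normc (f (x +i* y)) <= M.
    move=> hx hy; have := normc_leD (f (x +i* y) - f (p +i* q)) (f (p +i* q)).
    rewrite subrK => h; apply: le_trans h _; rewrite addrC lerD2l ltW//.
    apply: near_a; apply: le_lt_trans (normc_le_Re_Im _) _ => /=.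
    have : `|x - p| <= d by rewrite ler_norml; lra.
    have : `|y - q| <= d by rewrite ler_norml; lra.
    lra.
  have -> : 8 * M * d = 2 * M * ((p + d) - (p - d)) + 2 * M * ((q + d) - (q - d)) by ring.
  apply: (@loop_near _ f 0) => //; try lra.
    move=> x hx; rewrite mul0r subr0; apply: le_trans (ler_normB _ _) _.
    have := abs_Im_le (f (x +i* (q - d))); have := abs_Im_le (f (x +i* (q + d))).
    have := near x (q - d) hx; have := near x (q + d) hx; lra.
  move=> y hy; rewrite mul0r subr0; apply: le_trans (ler_normB _ _) _.
  have := abs_Re_le (f ((p - d) +i* y)); have := abs_Re_le (f ((p + d) +i* y)).
  have h1 := near (p - d) y _ hy; have h2 := near (p + d) y _ hy; lra.
apply/eqP; rewrite -normr_le0; apply/ler_addgt0Pl => e e0; rewrite addr0.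
set d1 := Num.min (Num.min (d0 / 2) (p - x1)) (Num.min (x2 - p) (Num.min (q - y1) (y2 - q))).
set d := Num.min (d1 / 2) (e / (8 * M + 1)).
have d10 : 0 < d1 by rewrite /d1 !lt_min; lra.
have e1 : 0 < e / (8 * M + 1) by rewrite divr_gt0//; lra.
have : d <= e / (8 * M + 1) by rewrite /d ge_min lexx orbT.
have : d < d1 by rewrite /d gt_min; apply/orP; left; lra.
have : 0 < d by rewrite /d lt_min e1 andbT; lra.
move=> dgt; rewrite {1}/d1 !lt_min => /and3P[/andP[? ?] ? /andP[? ?]].
rewrite ler_pdivlMr; last lra.
move=> h; apply: le_trans (small d _ _ _ _ _ _) _ => //; lra.
Qed.

End Goursat.

(** * Difference quotients *)

Section Liouville.
Context {R : realType}.
Implicit Types (f g : R[i] -> R[i]).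

Lemma normcP_cvg f z : (forall e : R, 0 < e -> exists2 d : R, 0 < d &
    forall w, normc (w - z) < d -> normc (f w - f z) <= e) -> {for z, continuous f}.
Proof.
move=> h; apply/(@cvgrPdist_le _ _ _ (nbhs z)) => e e0.
have eE : (Re e)%:C = e by apply: RRe_real; exact: gtr0_real.
have [|d d0 hd] := h (Re e); first by rewrite -ltcR eE.
apply/nbhs_ballP; exists d%:C => /=; first by rewrite ltcR.
move=> w; rewrite /ball/= distrC normcC ltcR => /hd.
by rewrite distrC normcC -eE lecR.
Qed.

Definition slope g (a l z : R[i]) := if z == a then l else (g z - g a) / (z - a).

Lemma slope_continuous_at g a l :
  (forall e : R, 0 < e -> exists2 d : R, 0 < d & forall w, normc (w - a) < d ->
    normc (g w - g a - l * (w - a)) <= e * normc (w - a)) ->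
  {for a, continuous (slope g a l)}.
Proof.
move=> h; apply: normcP_cvg => e e0; have [d d0 hd] := h _ e0; exists d => // w /hd.
rewrite /slope eqxx; case: eqVneq => [->|wa]; first by move=> _; rewrite subrr normc0 ltW.
have wa1 : w - a != 0 by rewrite subr_eq0.
have -> : (g w - g a) / (w - a) - l = (g w - g a - l * (w - a)) / (w - a) by field.
by rewrite normcM normcV ler_pdivrMr ?normc_gt0.
Qed.

Lemma cdiff_continuous f z : cdiff f z -> {for z, continuous f}.
Proof.
move=> [l h]; apply: normcP_cvg => e e0; have [d d0 hd] := h 1 ltr01.
have nl := normc_ge0 l.
exists (Num.min d (e / (1 + normc l))) => [|w]; first by rewrite lt_min d0 divr_gt0//; lra.
rewrite lt_min ltr_pdivlMr; last lra.
move=> /andP[/hd h1 h2].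
have := normc_leD (f w - f z - l * (w - z)) (l * (w - z)).
rewrite subrK normcM; lra.
Qed.

Lemma cdiffZ f (c z : R[i]) : cdiff f z -> cdiff (fun w => c * f w) z.
Proof.
move=> [l h]; exists (c * l) => e e0; have nc := normc_ge0 c.
have [|d d0 hd] := h (e / (1 + normc c)); first by rewrite divr_gt0//; lra.
exists d => // w /hd h1.
rewrite -mulrA -!mulrBr normcM.
apply: le_trans (ler_wpM2l nc h1) _; rewrite mulrA ler_wpM2r ?normc_ge0//.
rewrite mulrA ler_pdivrMr; first by rewrite mulrC ler_pM2l//; lra.
lra.
Qed.

(** [m'] is the derivative given by the quotient rule. The error is that of g plus a second-order
    term, each at most [e * D / 4] times [normc (w - z)], over a denominator [w - a] of modulus at
    least [D / 2]. *)
Lemma slope_cdiff g (a l z : R[i]) : cdiff g z -> z != a -> cdiff (slope g a l) z.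
Proof.
move=> [m h] za; have za0 : z - a != 0 by rewrite subr_eq0.
set m' := (m - (g z - g a) / (z - a)) / (z - a).
exists m' => e e0.
set D := normc (z - a); have D0 : 0 < D by rewrite /D normc_gt0.
have nm := normc_ge0 m'.
have [|d d0 hd] := h (e * D / 4); first by rewrite divr_gt0// mulr_gt0.
have e1 : 0 < e * D / (4 * (1 + normc m')) by rewrite divr_gt0 ?mulr_gt0//; lra.
exists (Num.min d (Num.min (D / 2) (e * D / (4 * (1 + normc m'))))) => [|w].
  by rewrite !lt_min d0 e1 andbT/=; lra.
rewrite !lt_min => /and3P[/hd h1 h2 h3].
have hw : D / 2 <= normc (w - a).
  have := normc_leD (w - a) (z - w); rewrite [_ + (z - w)]addrC addrA subrK -/D.
  rewrite [normc (z - w)]normcB; lra.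
have wa0 : w - a != 0 by rewrite -normc_gt0; lra.
have wa : (w == a) = false by apply/negbTE; rewrite -subr_eq0.
rewrite /slope wa (negbTE za).
have -> : (g w - g a) / (w - a) - (g z - g a) / (z - a) - m' * (w - z) =
  (g w - g z - m * (w - z) - (w - z) * (m' * (w - z))) / (w - a).
  by rewrite /m'; field; rewrite wa0 za0.
rewrite normcM normcV ler_pdivrMr; last lra.
have h4 : normc (m' * (w - z)) <= e * D / 4.
  rewrite normcM; move: h3; rewrite ltr_pdivlMr; last lra.
  have := normc_ge0 (w - z); have : 0 <= normc m' * normc (w - z) by rewrite mulr_ge0 ?normc_ge0.
  lra.
apply: le_trans (normc_leD _ _) _; rewrite normcN normcM.
apply: le_trans (lerD h1 (ler_wpM2l (normc_ge0 _) h4)) _.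
rewrite (_ : _ + _ = e * normc (w - z) * (D / 2)); last by field.
by rewrite ler_wpM2l// mulr_ge0 ?normc_ge0// ltW.
Qed.

End Liouville.

(** * Entire functions of linear growth *)

Section LinearGrowth.
Context {R : realType}.
Implicit Types (f g : R[i] -> R[i]).

Lemma slope_loop g (a : R[i]) : (forall z, cdiff g z) ->
  exists l, continuous (slope g a l) /\
    forall r, normc a < r -> loop (slope g a l) (- r) r (- r) r = 0.
Proof.
move=> dg; have [l hl] := dg a; exists l.
have dk z : z != a -> cdiff (slope g a l) z by exact: slope_cdiff.
have ck : continuous (slope g a l).
  move=> z; have [->|/dk/cdiff_continuous//] := eqVneq z a.
  exact: slope_continuous_at.
split => // r ar; apply: (@goursat_puncture _ _ a) => //.
- by have := abs_Re_le a; rewrite ler_norml; lra.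
- by have := abs_Im_le a; rewrite ler_norml; lra.
Qed.

(** w is close to - 1 / z. For |y| <= x one has x^2 + y^2 <= 2 x^2, and an error of 1 / 4 in z w
    turns the numerator - x of the real part into at most - x / 2. *)
Lemma Re_side_le (z w : R[i]) : 0 < Re z -> `|Im z| <= Re z ->
  normc (z * w + 1) <= 1 / 4 -> Re w <= - (4 * Re z)^-1.
Proof.
move=> x0 yx h.
set e := z * w + 1.
have he : normc e <= 1 / 4 by [].
have z0 : z != 0 by apply: contraTneq x0 => ->; rewrite ltxx.
have wE : w = (e - 1) / z by rewrite /e; field.
case: z e he z0 wE x0 yx {h} => x y [p q] he z0 -> /= x0 yx.
have s0 : 0 < x ^+ 2 + y ^+ 2 by rewrite ltr_wpDr ?sqr_ge0// exprn_gt0.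
have yy : y ^+ 2 <= x ^+ 2 by rewrite -(real_normK (num_real y)) ler_sqr// nnegrE// ltW.
have := le_trans (abs_Re_le _) he; have := le_trans (abs_Im_le _) he.
rewrite /= => hq hp.
have -> : (p - 1) * (x / (x ^+ 2 + y ^+ 2)) - (q - 0) * - (y / (x ^+ 2 + y ^+ 2)) =
  ((p - 1) * x + q * y) / (x ^+ 2 + y ^+ 2) by field; rewrite gt_eqF.
rewrite ler_pdivrMr//.
have qy : q * y <= 1 / 4 * x.
  by apply: le_trans (ler_norm _) _; rewrite normrM ler_pM.
have px : (p - 1) * x <= - (3 / 4) * x by rewrite ler_pM2r//; move: hp; rewrite ler_norml; lra.
have : (4 * x)^-1 * (x ^+ 2 + y ^+ 2) <= x / 2.
  rewrite mulrC ler_pdivrMr ?mulr_gt0//.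
  rewrite (_ : x / 2 * (4 * x) = x ^+ 2 + x ^+ 2); first by rewrite lerD2l.
  by rewrite expr2; field.
by rewrite mulNr; lra.
Qed.

(** f is close to - 1 / z, whose loop has imaginary part - 2 pi. Each side is the right-hand one
    multiplied by 1, i, - i or - 1, and on that side [Re_side_le] bounds the integrand by - 1 / (4
    r) over a length 2 r; the four sides give at most - 2. *)
Lemma loop_lt0 f (r : R) : continuous f -> 0 < r ->
  (forall z, r <= normc z -> normc (z * f z + 1) <= 1 / 4) ->
  loop f (- r) r (- r) r < 0.
Proof.
move=> cf r0 h.
have rr : - r <= r by lra.
have big z : r <= `|Re z| \/ r <= `|Im z| -> normc (z * f z + 1) <= 1 / 4.
  move=> hz; apply: h; case: hz => /le_trans; apply; [exact: abs_Re_le|exact: abs_Im_le].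
have side (n z : R[i]) t : n != 0 -> z = n * (r +i* t) -> - r <= t <= r ->
    r <= `|Re z| \/ r <= `|Im z| -> Re (n * f z) <= - (4 * r)^-1.
  move=> n0 -> tr /big hz; apply: (@Re_side_le (r +i* t)) => //=.
    by rewrite ler_norml.
  by rewrite mulrCA mulrA.
have i0 : 'i != 0 :> R[i] by rewrite eq_complex/= eqxx oner_eq0.
have iN0 : - 'i != 0 :> R[i] by rewrite oppr_eq0.
have c : - (4 * r)^-1 * (r - - r) = - (1 / 2) :> R by field; rewrite gt_eqF.
have B : oint (fun x => Im (f (x +i* - r))) (- r) r <= - (1 / 2).
  rewrite -c; apply: oint_le => //; first exact: continuous_Im_hline.
  move=> x hx; have := @side (- 'i) (x +i* - r) x iN0.
  rewrite (_ : Re (- 'i * _) = Im (f (x +i* - r))); last by case: (f _) => p q /=; ring.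
  apply=> //; last by right; rewrite /= normrN gtr0_norm.
  by apply/eqP; rewrite eq_complex/=; apply/andP; split; apply/eqP; ring.
have C : oint (fun y => Re (f (r +i* y))) (- r) r <= - (1 / 2).
  rewrite -c; apply: oint_le => //; first exact: continuous_Re_vline.
  move=> y hy; have := @side 1 (r +i* y) y (oner_neq0 _); rewrite !mul1r; apply=> //.
  by left; rewrite /= gtr0_norm.
have D : oint (fun x => - Im (f (x +i* r))) (- r) r <= - (1 / 2).
  rewrite -c; apply: oint_le => //.
    by move=> x; apply: cvgN; exact: continuous_Im_hline.
  move=> x hx; have := @side 'i (x +i* r) (- x) i0.
  rewrite (_ : Re ('i * _) = - Im (f (x +i* r))); last by case: (f _) => p q /=; ring.
  apply=> //; last by right; rewrite /= gtr0_norm.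
    by apply/eqP; rewrite eq_complex/=; apply/andP; split; apply/eqP; ring.
  by move: hx; lra.
have E : oint (fun y => - Re (f (- r +i* y))) (- r) r <= - (1 / 2).
  rewrite -c; apply: oint_le => //.
    by move=> x; apply: cvgN; exact: continuous_Re_vline.
  move=> y hy; have N0 : -1 != 0 :> R[i] by rewrite oppr_eq0 oner_eq0.
  have := @side (-1) (- r +i* y) (- y) N0; rewrite !mulN1r raddfN; apply=> //.
  - by apply/eqP; rewrite eq_complex/= opprK !eqxx.
  - by move: hy; lra.
  by left; rewrite /= normrN gtr0_norm.
rewrite !ointN in D E; [|exact: continuous_Re_vline|exact: continuous_Im_hline].
rewrite /loop; lra.
Qed.

Lemma normc_half (z b : R[i]) : 2 * normc b <= normc z -> 0 < normc z ->
  z - b != 0 /\ normc (z - b)^-1 <= 2 / normc z.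
Proof.
move=> bz z0.
have h : normc z / 2 <= normc (z - b).
  by have := normc_leD (z - b) b; rewrite subrK; lra.
have zb : 0 < normc (z - b) by lra.
split; first by rewrite -normc_gt0.
by rewrite normcV -[2 / _]invf_div lef_pV2 ?posrE//; lra.
Qed.

(* With weights [w_j] and nodes [a_j = 0, 1, x] such that [sum w_j = sum w_j a_j = 0], the
   sum of [w_j (g z - g a_j) / (z - a_j)] is [- A / z + O(z^-2)], where
   [A = sum w_j g(a_j)], so its integral along large squares vanishes only if [A = 0]. *)
Theorem linear_growth_affine g (K : R) : (forall z, cdiff g z) ->
  (forall z, normc (g z) <= K * (1 + normc z)) ->
  forall x, g x = g 0 + x * (g 1 - g 0).
Proof.
move=> dg gK x.
have [->|x0] := eqVneq x 0; first by rewrite mul0r addr0.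
have [->|x1] := eqVneq x 1; first by rewrite mul1r addrC subrK.
set A := (1 - x) * g 0 + x * g 1 - g x.
suff A0 : A = 0.
  by transitivity (g x + A); [rewrite A0 addr0|rewrite /A; ring].
apply/eqP/negP => /negP A0.
have dcg c z : cdiff (fun w => c * g w) z by exact: cdiffZ.
(* The weights [1 - x], [x], [- 1] are divided by [A], so that [z * T z] tends to - 1, as [loop_lt0]
   requires. *)
have [l0 [c0 h0]] := slope_loop 0 (dcg ((1 - x) / A)).
have [l1 [c1 h1]] := slope_loop 1 (dcg (x / A)).
have [l2 [c2 h2]] := slope_loop x (dcg (- 1 / A)).
set T0 := slope _ 0 l0 in c0 h0; set T1 := slope _ 1 l1 in c1 h1; set T2 := slope _ x l2 in c2 h2.
pose T z := T0 z + T1 z + T2 z.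
have c01 : continuous (fun z => T0 z + T1 z).
  by move=> z; exact: (@continuousD _ _ _ T0 T1 z (c0 z) (c1 z)).
have cT : continuous T.
  by move=> z; exact: (@continuousD _ _ _ (fun z => T0 z + T1 z) T2 z (c01 z) (c2 z)).
have loopT r : 1 + normc x < r -> loop T (- r) r (- r) r = 0.
  move=> xr; have nx := normc_ge0 x.
  rewrite /T (loopD _ _ _ _ c01 c2) (loopD _ _ _ _ c0 c1) h0 ?normc0; last lra.
  by rewrite h1 ?normc1 ?h2 ?addr0; lra.
have K0 : 0 <= K by have := le_trans (normc_ge0 _) (gK 0); rewrite normc0 addr0 mulr1.
(* The 8 is 2^3: [1 + normc z <= 2 * normc z], and each of [(z - 1)^-1], [(z - x)^-1] has modulus at
   most [2 / normc z]. *)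
set M := normc A^-1 * (8 * normc (x * (1 - x)) * K + 2 * normc (x * g 1) + 2 * normc (x * g x)).
have M0 : 0 <= M by rewrite mulr_ge0 ?normc_ge0// !addr_ge0 ?mulr_ge0 ?normc_ge0.
(* The first summand puts 1 and x within half of [normc z], the second makes [M / normc z] at most 1
   / 4. *)
pose r := 2 * (1 + normc x) + 4 * M.
have nx := normc_ge0 x.
have r0 : 0 < r by rewrite /r; lra.
have := @loop_lt0 T r cT r0; rewrite loopT ?ltxx; last by rewrite /r; lra.
suff H : forall z, r <= normc z -> normc (z * T z + 1) <= 1 / 4 by move=> /(_ H).
move=> z rz.
have nz : 0 < normc z by lra.
have z0 : z != 0 by rewrite -normc_gt0.
have [|z1 hz1] := @normc_half z 1 _ nz; first by rewrite normc1 /r in rz *; lra.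
have [|zx hzx] := @normc_half z x _ nz; first by rewrite /r in rz *; lra.
have -> : z * T z + 1 = A^-1 * (x * (1 - x) * g z * ((z - 1)^-1 * (z - x)^-1)
    + - (x * g 1 * (z - 1)^-1) + x * g x * (z - x)^-1).
  rewrite /T /T0 /T1 /T2 /slope (negbTE z0) -(subr_eq0 z 1) (negbTE z1)
    -(subr_eq0 z x) (negbTE zx) subr0.
  by move: A0; rewrite /A => A0; field; rewrite z0 z1 zx A0.
rewrite normcM.
have B1 : normc (x * (1 - x) * g z * ((z - 1)^-1 * (z - x)^-1))
    <= 8 * normc (x * (1 - x)) * K / normc z.
  rewrite !(normcM (x * (1 - x) * g z)) (normcM _ (g z)) (normcM (z - 1)^-1) -mulrA.
  rewrite (_ : 8 * _ * K / _ = normc (x * (1 - x)) *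
    (K * (normc z + normc z) * (2 / normc z * (2 / normc z)))); last first.
    by field; rewrite gt_eqF.
  rewrite ler_wpM2l ?normc_ge0// ler_pM ?mulr_ge0 ?normc_ge0//.
    by apply: le_trans (gK z) _; rewrite ler_wpM2l// lerD2r; rewrite /r in rz; lra.
  by rewrite ler_pM ?normc_ge0.
have B2 : normc (x * g 1 * (z - 1)^-1) <= 2 * normc (x * g 1) / normc z.
  by rewrite normcM (mulrC 2) -mulrA ler_wpM2l ?normc_ge0.
have B3 : normc (x * g x * (z - x)^-1) <= 2 * normc (x * g x) / normc z.
  by rewrite normcM (mulrC 2) -mulrA ler_wpM2l ?normc_ge0.
apply: le_trans (_ : M / normc z <= _); last first.
  by rewrite ler_pdivrMr//; rewrite /r in rz; lra.
rewrite /M -[leRHS]mulrA ler_wpM2l ?normc_ge0//.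
rewrite [leRHS]mulrDl [X in _ <= X + _]mulrDl.
apply: le_trans (normc_leD _ _) _; apply: lerD => //.
by apply: le_trans (normc_leD _ _) _; rewrite normcN; apply: lerD.
Qed.

End LinearGrowth.

(** * Lifting to R of maps with values in R/Z *)

Section RealLifting.
Context {R : realType} {V : normedModType R[i]}.
Implicit Types (x y z p : V) (s t u : R) (F G T : V -> R).

(** The norm of [V] has its values in [R[i]], where the order is partial; being real, they are
    carried back to [R]. *)
Definition nrm x : R := Re `|x|.

Lemma nrmE x : `|x| = (nrm x)%:C.
Proof. by rewrite /nrm RRe_real// ger0_real. Qed.

Lemma nrm_ge0 x : 0 <= nrm x.
Proof. by rewrite -ler0c -nrmE. Qed.

Lemma nrm_eq0 x : (nrm x == 0) = (x == 0).
Proof. by rewrite -(inj_eq (@complexI _)) -nrmE normr_eq0. Qed.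

Lemma nrm_gt0 x : (0 < nrm x) = (x != 0).
Proof. by rewrite lt0r nrm_ge0 andbT nrm_eq0. Qed.

Lemma nrm0 : nrm 0 = 0.
Proof. by apply/eqP; rewrite nrm_eq0. Qed.

Lemma nrmD x y : nrm (x + y) <= nrm x + nrm y.
Proof. by have := ler_normD x y; rewrite !nrmE -rmorphD lecR. Qed.

Lemma nrmN x : nrm (- x) = nrm x.
Proof. by rewrite /nrm normrN. Qed.

Lemma nrmB x y : nrm (x - y) = nrm (y - x).
Proof. by apply: complexI; rewrite -!nrmE distrC. Qed.

Lemma nrmZ (c : R[i]) x : nrm (c *: x) = normc c * nrm x.
Proof. by apply: complexI; rewrite -nrmE normrZ normcC nrmE -rmorphM. Qed.

Lemma nrmZR s x : nrm (s%:C *: x) = `|s| * nrm x.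
Proof. by rewrite nrmZ /= expr0n/= addr0 sqrtr_sqr. Qed.

Lemma nrmB_lt x y z (a b : R) : nrm (x - y) < a -> nrm (y - z) < b -> nrm (x - z) < a + b.
Proof.
move=> h1 h2; rewrite (_ : x - z = (x - y) + (y - z)); last by rewrite addrA subrK.
exact: le_lt_trans (nrmD _ _) (ltrD h1 h2).
Qed.

Definition rcont F x := forall e : R, 0 < e -> exists2 d : R, 0 < d &
  forall y, nrm (y - x) < d -> `|F y - F x| < e.

Lemma rcontD F G x : rcont F x -> rcont G x -> rcont (fun y => F y + G y) x.
Proof.
move=> hF hG e e0; have e2 : 0 < e / 2 by lra.
have [d d0 h1] := hF _ e2; have [d' d'0 h2] := hG _ e2.
exists (Num.min d d') => [|y]; first by rewrite lt_min d0.
rewrite lt_min => /andP[/h1 {}h1 /h2 {}h2]; rewrite opprD addrACA.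
by apply: le_lt_trans (ler_normD _ _) _; lra.
Qed.

Lemma rcontN F x : rcont F x -> rcont (fun y => - F y) x.
Proof.
move=> hF e /hF[d d0 h]; exists d => // y /h.
by rewrite -opprD normrN.
Qed.

Lemma rcont_cst (c : R) x : rcont (fun=> c) x.
Proof. by move=> e e0; exists 1 => // y _; rewrite subrr normr0. Qed.

Lemma rcont_near F G x (d : R) : 0 < d -> (forall y, nrm (y - x) < d -> F y = G y) ->
  rcont F x -> rcont G x.
Proof.
move=> d0 FG hF e /hF[d' d'0 h]; exists (Num.min d d') => [|y]; first by rewrite lt_min d0.
rewrite lt_min => /andP[yd /h]; rewrite (FG _ yd) (FG x)//.
by rewrite subrr nrm0.
Qed.

Definition segm x y s : V := x + s%:C *: (y - x).

Lemma segm0 x y : segm x y 0 = x.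
Proof. by rewrite /segm scale0r addr0. Qed.

Lemma segm1 x y : segm x y 1 = y.
Proof. by rewrite /segm scale1r addrC subrK. Qed.

Lemma segmB x y s t : segm x y s - segm x y t = (s - t)%:C *: (y - x).
Proof. by rewrite /segm opprD addrACA subrr add0r -scalerBl -rmorphB. Qed.

(** Distinct integers are at least 1 apart, so by the intermediate value theorem a nonconstant F
    would take the smaller end value plus 1 / 2. *)
Lemma int_valued_segm F x y :
  (forall s, 0 <= s <= 1 -> rcont F (segm x y s) /\ F (segm x y s) \is a Num.int) ->
  F x = F y.
Proof.
move=> h.
(* Clamping s to [0, 1] gives a function continuous on all of R from hypotheses on the segment
   only. *)
pose f s := F (segm x y (Num.max 0 (Num.min 1 s))).
have clip s : 0 <= Num.max 0 (Num.min 1 s) <= 1.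
  by rewrite le_max lexx/= ge_max ler01 ge_min lexx.
have cf : continuous f.
  move=> s; apply/cvgrPdist_lt => e e0.
  have [d d0 hd] := (h _ (clip s)).1 _ e0.
  near=> t; rewrite distrC; apply: hd; rewrite segmB nrmZR.
  have : `|Num.max 0 (Num.min 1 t) - Num.max 0 (Num.min 1 s)| <= `|t - s|.
    rewrite /Order.max /Order.min; do ?case: ifPn; rewrite -?leNgt => *;
      rewrite ?subrr ?normr0//;
      (case: (lerP 0 (t - s)) => ?; [rewrite [leRHS]ger0_norm// |rewrite [leRHS]ltr0_norm// ]);
      rewrite ler_norml; lra.
  have : `|s - t| < d / (1 + nrm (y - x)).
    near: t; apply: cvgr_dist_lt; first exact: cvg_id.
    by rewrite divr_gt0//; have := nrm_ge0 (y - x); lra.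
  have nn := nrm_ge0 (y - x); rewrite ltr_pdivlMr; last lra.
  rewrite distrC => h1 /(fun X => ler_wpM2r nn X) h2.
  by have := normr_ge0 (t - s); lra.
have f0 : f 0 = F x by rewrite /f min_r// maxxx segm0.
have f1 : f 1 = F y by rewrite /f minxx max_r// segm1.
have fi s : f s \is a Num.int by case: (h _ (clip s)).
rewrite -f0 -f1.
have : {in `[0, 1], forall s, Num.min (f 0) (f 1) + 1 / 2 != f s}.
  move=> s _; apply/eqP => fs.
  have /intrP[m hm] : f s - Num.min (f 0) (f 1) \is a Num.int.
    by rewrite rpredB// /Order.min; case: ifP.
  have : (m%:~R : R) = 1 / 2 by rewrite -hm -fs addrC addKr.
  move=> mh; have : m * 2 = 1.
    apply: (@intr_inj R); rewrite rmorphM/= mh; lra.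
  lia.
move=> no; apply/eqP; rewrite -subr_eq0; apply: contraT => ne.
have gap := norm_intr_ge1 (rpredB (fi 0) (fi 1)) ne.
have [|c c01 hc] := @IVT _ f 0 1 (Num.min (f 0) (f 1) + 1 / 2) ler01 (continuous_subspaceT cf).
  by move: gap; rewrite /Order.min /Order.max; case: ltrP => f01;
    rewrite ?(ltr0_norm (_ : f 0 - f 1 < 0)) ?(ger0_norm (_ : 0 <= f 0 - f 1)); lra.
by have := no c c01; rewrite hc eqxx.
Unshelve. all: by end_near. Qed.

(* [T] is an arbitrary, possibly discontinuous, choice of representatives of a map to R/Z,
   and [F] lifts that map to R near [x]. *)
Definition lifts T F x := rcont F x /\ F x - T x \is a Num.int.

Lemma lifts_near T F G x (d : R) : 0 < d -> (forall y, nrm (y - x) < d -> F y = G y) ->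
  lifts T F x -> lifts T G x.
Proof.
move=> d0 FG [cF iF]; split; first exact: rcont_near FG cF.
by rewrite -FG// subrr nrm0.
Qed.

Lemma lifts_int T F G x : lifts T F x -> lifts T G x ->
  rcont (fun y => F y - G y) x /\ F x - G x \is a Num.int.
Proof.
move=> [cF iF] [cG iG]; split; first by apply: rcontD => //; exact: rcontN.
by rewrite -(subrKA (T x)) -[X in _ + X]opprB rpredB.
Qed.

Lemma lifts_segm T F G x y :
  (forall s, 0 <= s <= 1 -> lifts T F (segm x y s) /\ lifts T G (segm x y s)) ->
  F x - G x = F y - G y.
Proof.
move=> h; apply: (@int_valued_segm (fun y => F y - G y)) => s /h[].
exact: lifts_int.
Qed.

End RealLifting.

(** * Lifting over starshaped domains *)

Section StarLifting.
Context {R : realType} {V : normedModType R[i]}.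
Implicit Types (x y z p : V) (s t u : R) (F G T : V -> R).

Definition tube p x s (r : R) : set V :=
  [set y | exists2 u, 0 <= u <= s & nrm (y - segm p x u) < r].

Lemma segmE x y s : segm x y s = (1 - s)%:C *: x + s%:C *: y.
Proof.
by rewrite /segm rmorphB rmorph1 scalerBr scalerBl scale1r addrA addrAC.
Qed.

Lemma segm_comb p x u v l :
  segm p x ((1 - l) * u + l * v) = (1 - l)%:C *: segm p x u + l%:C *: segm p x v.
Proof.
rewrite !segmE !scalerDr !scalerA addrACA -!scalerDl -!rmorphM -!rmorphD.
by congr (_%:C *: _ + _); ring.
Qed.

(** Convexity of tubes: two lifts over a tube can then be compared along segments that stay inside
    it. *)
Lemma segm_tube p x s r y z l : tube p x s r y -> tube p x s r z -> 0 <= l <= 1 ->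
  tube p x s r (segm y z l).
Proof.
move=> [u us yu] [v vs zv] /andP[l0 l1]; exists ((1 - l) * u + l * v).
  move: us vs => /andP[u0 us] /andP[v0 vs].
  have m0 : 0 <= 1 - l by lra.
  rewrite addr_ge0 ?mulr_ge0//=.
  have := ler_wpM2l m0 us; have := ler_wpM2l l0 vs; lra.
have -> : segm y z l - segm p x ((1 - l) * u + l * v) =
    (1 - l)%:C *: (y - segm p x u) + l%:C *: (z - segm p x v).
  by rewrite segm_comb (segmE y z) !scalerBr opprD addrACA.
apply: le_lt_trans (nrmD _ _) _; rewrite !nrmZR !ger0_norm//; last lra.
have [->|l0'] := eqVneq l 0; first by rewrite subr0 mul0r addr0 mul1r.
have lgt : 0 < l by rewrite lt0r l0'.
have m0 : 0 <= 1 - l by lra.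
have := ler_wpM2l m0 (ltW yu); have : l * nrm (z - segm p x v) < l * r by rewrite ltr_pM2l.
lra.
Qed.

Lemma tube_open p x s r y : tube p x s r y ->
  exists2 d : R, 0 < d & forall z, nrm (z - y) < d -> tube p x s r z.
Proof.
move=> [u us yu]; exists (r - nrm (y - segm p x u)); first by rewrite subr_gt0.
move=> z zy; exists u => //; rewrite -(subrK (nrm (y - segm p x u)) r).
rewrite (_ : z - _ = (z - y) + (y - segm p x u)); last by rewrite addrA subrK.
by apply: le_lt_trans (nrmD _ _) _; rewrite ltrD2r.
Qed.

Lemma tube_start p x s r : 0 <= s -> 0 < r -> tube p x s r p.
Proof. by move=> s0 r0; exists 0; rewrite ?lexx// segm0 subrr nrm0. Qed.

Lemma segm_ball p (r : R) y z l : nrm (y - p) < r -> nrm (z - p) < r -> 0 <= l <= 1 ->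
  nrm (segm y z l - p) < r.
Proof.
move=> yp zp /(@segm_tube p p 0 r y z l) [||u _].
- by exists 0; rewrite ?lexx// segm0.
- by exists 0; rewrite ?lexx// segm0.
by rewrite {2}/segm subrr scaler0 addr0.
Qed.

(** The value at p is prescribed so that lifts along different segments from p agree where they
    meet. *)
Definition tube_lift T p x s := exists r : R, 0 < r /\ exists F,
  F p = T p /\ forall y, tube p x s r y -> lifts T F y.

(** G is shifted by the integer-compatible constant that makes it agree with F at [segm p x s]. The
    tube and the ball are both convex, so the two lifts agree on the whole overlap and glue; the
    radius [r / 2] keeps the new part of the tube inside the ball. *)
Lemma tube_lift_extend T p x s0 s1 (z := segm p x s0) (r : R) G s :
  0 <= s <= s0 -> s <= s1 -> 0 < r -> (forall y, nrm (y - z) < r -> lifts T G y) ->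
  (s0 - s) * nrm (x - p) < r / 2 -> (s1 - s0) * nrm (x - p) < r / 2 ->
  tube_lift T p x s -> tube_lift T p x s1.
Proof.
move=> /andP[s_ge0 ss0] ss1 r0 lG hs hs1 [r' [r'0 [F [Fp lF]]]].
set zs := segm p x s.
have zsz : nrm (zs - z) < r.
  by rewrite segmB nrmZR ler0_norm ?opprB; lra.
have zst : tube p x s r' zs by exists s; rewrite ?lexx ?s_ge0// subrr nrm0.
pose G' y := G y + (F zs - G zs).
have lG' y : nrm (y - z) < r -> lifts T G' y.
  move=> /lG [cG iG]; split; first by apply: rcontD => //; exact: rcont_cst.
  by rewrite /G' addrAC rpredD//; case: (lifts_int (lF _ zst) (lG _ zsz)).
have FG' y : tube p x s r' y -> nrm (y - z) < r -> F y = G' y.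
  move=> ty yz; apply/eqP; rewrite -subr_eq0; apply/eqP.
  rewrite -(@lifts_segm _ _ T F G' zs y); first by rewrite /G' addrCA subrr addr0 subrr.
  by move=> l l01; split; [apply: lF; exact: segm_tube|apply: lG'; exact: segm_ball].
pose H y := if `[< tube p x s r' y >] then F y else G' y.
have HG' y : nrm (y - z) < r -> H y = G' y.
  by move=> yz; rewrite /H; case: asboolP => // ty; exact: FG'.
exists (Num.min r' (r / 2)); split; first by rewrite lt_min r'0; lra.
exists H; split; first by rewrite /H; case: asboolP => // -[]; exact: tube_start.
move=> y [u us]; rewrite lt_min => /andP[yu yu2].
have [us'|su] := leP u s.
  have ty : tube p x s r' y by exists u => //; rewrite us' andbT; case/andP: us.
  have [d d0 hd] := tube_open ty.
  apply: (lifts_near d0 _ (lF _ ty)) => w /hd tw.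
  by rewrite /H; case: asboolP.
have yz : nrm (y - z) < r.
  rewrite (_ : r = r / 2 + r / 2); last lra.
  apply: nrmB_lt yu2 _; rewrite segmB nrmZR.
  have nn := nrm_ge0 (x - p); move: us => /andP[u0 us].
  have h1 : `|u - s0| <= Num.max (s0 - s) (s1 - s0).
    by rewrite le_max !ler_norml; case: (lerP u s0) => ?; apply/orP; [left|right]; lra.
  apply: le_lt_trans (ler_wpM2r nn h1) _.
  by rewrite /Order.max; case: ifP.
have d0 : 0 < r - nrm (y - z) by rewrite subr_gt0.
apply: (lifts_near d0 _ (lG' _ yz)) => w wy; apply/esym/HG'.
rewrite (_ : w - z = (w - y) + (y - z)); last by rewrite addrA subrK.
by apply: le_lt_trans (nrmD _ _) _; rewrite -ltrBrDr.
Qed.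

Definition locally_lifts T x := exists G, exists2 r : R, 0 < r &
  forall y, nrm (y - x) < r -> lifts T G y.

(** The parameters reached by a lift have a supremum; a local lift around that point bridges from
    below it to beyond it, which forces the supremum to be 1 and attained. *)
Lemma locally_lifts_tube T p x : (forall s, 0 <= s <= 1 -> locally_lifts T (segm p x s)) ->
  tube_lift T p x 1.
Proof.
move=> lT.
have [G [r r0 lG]] : locally_lifts T p by rewrite -(segm0 p x); apply: lT; rewrite lexx ler01.
pose S := [set s | 0 <= s <= 1 /\ tube_lift T p x s].
have S0 : S 0.
  split; first by rewrite lexx ler01.
  exists r; split => //; exists (fun y => G y + (T p - G p)); split; first by rewrite addrC subrK.
  move=> y [u /le_anti <-]; rewrite segm0 => /lG[cG iG]; split.
    by apply: rcontD => //; exact: rcont_cst.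
  rewrite addrAC rpredD// -opprB rpredN; case: (lG p) => //; by rewrite subrr nrm0.
have supS : has_sup S by split; [exists 0|exists 1 => s [/andP[]]].
set s0 := sup S.
have s00 : 0 <= s0 by apply: sup_upper_bound.
have s01 : s0 <= 1 by apply: ge_sup => [|s [/andP[]]//]; exists 0.
have [G' [r' r'0 lG']] : locally_lifts T (segm p x s0) by apply: lT; rewrite s00.
have nn := nrm_ge0 (x - p).
(* Parameter steps shorter than [d] move the point by less than [r' / 2]; the [1 +] covers
   [x = p]. *)
set d := r' / 2 / (1 + nrm (x - p)).
have d0 : 0 < d by rewrite /d !divr_gt0//; lra.
have dn e : 0 <= e < d -> e * nrm (x - p) < r' / 2.
  move=> /andP[e0]; rewrite /d ltr_pdivlMr; lra.
have [s [s_01 Ts] s_s0] := sup_adherent d0 supS.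
have ss0 : s <= s0 by apply: sup_upper_bound.
have s1S : S (Num.min 1 (s0 + d / 2)).
  have m0 : s0 <= Num.min 1 (s0 + d / 2) by rewrite le_min s01/=; lra.
  split; first by rewrite ge_min lexx andbT; exact: le_trans m0.
  apply: (@tube_lift_extend _ _ _ s0 _ r' G' s) => //.
  - by rewrite ss0 andbT; case/andP: s_01.
  - exact: le_trans m0.
  - by apply: dn; rewrite -/s0 in s_s0; lra.
  - apply: dn; rewrite subr_ge0 m0/= ltrBlDl gt_min; apply/orP; right; lra.
have := sup_upper_bound supS s1S; rewrite -/s0 => h.
have <- : Num.min 1 (s0 + d / 2) = 1.
  by move: h; rewrite /Order.min; case: ifP => //; lra.
by case: s1S.
Qed.

(** The lift at x is the end value of the lift along the segment from p to x. For y near x the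
    segment to y stays in the tube around the segment to x, and the two lifts, equal at p, agree up
    to y. *)
Theorem starshaped_lift T (D : set V) p :
  (forall x, D x -> forall s, 0 <= s <= 1 -> D (segm p x s)) ->
  (forall x, D x -> exists2 d : R, 0 < d & forall y, nrm (y - x) < d -> D y) ->
  (forall x, D x -> locally_lifts T x) ->
  exists F, forall x, D x -> lifts T F x.
Proof.
move=> Dstar Dopen lT.
have /choice[F hF] : forall x, exists F, D x -> exists2 r : R, 0 < r & F p = T p /\
    forall y, tube p x 1 r y -> lifts T F y.
  move=> x; have [Dx|nD] := pselect (D x); last by exists T.
  have [r [r0 [F hF]]] := locally_lifts_tube (fun s hs => lT _ (Dstar _ Dx s hs)).
  by exists F => _; exists r.
exists (fun x => F x x) => x Dx.
have [r r0 [Fp lF]] := hF _ Dx.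
have [d d0 hd] := Dopen _ Dx.
have tx : tube p x 1 r x by exists 1; rewrite ?ler01 ?lexx// segm1 subrr nrm0.
have [d' d'0 hd'] := tube_open tx.
have dd : 0 < Num.min d d' by rewrite lt_min d0.
apply: (lifts_near dd _ (lF _ tx)) => y; rewrite lt_min => /andP[/hd Dy /hd' ty].
have [r2 r20 [Fp2 lF2]] := hF _ Dy.
have := @lifts_segm _ _ T (F x) (F y) p y.
rewrite Fp Fp2 subrr => h; apply/eqP; rewrite -subr_eq0 -h// => s s01; split.
  by apply: lF; apply: segm_tube => //; apply: tube_start; rewrite ?ler01.
apply: lF2; exists s => //; first by rewrite subrr nrm0.
Qed.

End StarLifting.

(** * Slit planes and the punctured plane *)

Section PlaneLifting.
Context {R : realType}.
Local Notation V := 'cV[R[i]]_2.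
Implicit Types (v w : V) (F T : V -> R) (a b : R[i]).

Definition vec a b : V := \col_i (if i == 0 then a else b).

Lemma vec0 a b : vec a b 0 0 = a. Proof. by rewrite mxE. Qed.
Lemma vec1 a b : vec a b 1 0 = b. Proof. by rewrite mxE. Qed.

Lemma cV2P v w : v 0 0 = w 0 0 -> v 1 0 = w 1 0 -> v = w.
Proof.
move=> h0 h1; apply/matrixP => i j; rewrite (ord1 j) {j}.
case: i => [[|[|//]]] hi.
  by rewrite (_ : Ordinal hi = 0)//; exact: val_inj.
by rewrite (_ : Ordinal hi = 1)//; exact: val_inj.
Qed.

Lemma vecE v : v = vec (v 0 0) (v 1 0).
Proof. by apply: cV2P; rewrite ?vec0 ?vec1. Qed.

Lemma vec_eq0 a b : (vec a b == 0) = (a == 0) && (b == 0).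
Proof.
apply/eqP/andP => [h|[/eqP-> /eqP->]]; last by apply: cV2P; rewrite ?vec0 ?vec1 mxE.
by split; apply/eqP; [rewrite -(vec0 a b)|rewrite -(vec1 a b)]; rewrite h mxE.
Qed.

Lemma coord_le_nrm v i : normc (v i 0) <= nrm v.
Proof.
rewrite -lecR -normcC -nrmE [leRHS]/Num.Def.normr/= mx_normE.
have -> : `|v i 0| = (`|v i 0|%:nng)%:num by [].
rewrite num_le; exact: (@le_bigmax _ _ _ _ (fun i : 'I_2 * 'I_1 => `|v i.1 i.2|%:nng) (i, 0)).
Qed.

Lemma nrm_le_coord v : nrm v <= normc (v 0 0) + normc (v 1 0).
Proof.
rewrite -lecR -nrmE [leLHS]/Num.Def.normr/=.
have [->|/mx_norm_neq0[[i j] ->]] := eqVneq (mx_norm v) 0.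
  by rewrite lecR addr_ge0 ?normc_ge0.
rewrite /= normcC lecR (ord1 j) {j}; case: i => [[|[|//]]] hi.
  by rewrite (_ : Ordinal hi = 0) ?lerDl ?normc_ge0//; exact: val_inj.
by rewrite (_ : Ordinal hi = 1) ?lerDr ?normc_ge0//; exact: val_inj.
Qed.

Lemma segm_coord v w s i j :
  segm v w s i j = (1 - s)%:C * v i j + s%:C * w i j.
Proof. by rewrite segmE !mxE. Qed.

(** For e = 1 or e = -1, this is C^2 without the closed half-line of real points (x, 0) with e x <=
    0, and it is starshaped around (e, 0). *)
Definition slit (e : R) : set V :=
  [set v | v 1 0 != 0 \/ Im (v 0 0) != 0 \/ 0 < e * Re (v 0 0)].

Lemma ReMR (s : R) a : Re (s%:C * a) = s * Re a.
Proof. by case: a => p q /=; rewrite mul0r subr0. Qed.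

Lemma ImMR (s : R) a : Im (s%:C * a) = s * Im a.
Proof. by case: a => p q /=; rewrite mul0r addr0. Qed.

Lemma ReD a b : Re (a + b) = Re a + Re b. Proof. exact: raddfD. Qed.
Lemma ImD a b : Im (a + b) = Im a + Im b. Proof. exact: raddfD. Qed.

Lemma slit_star (e : R) v : 0 < e ^+ 2 -> slit e v -> forall s, 0 <= s <= 1 ->
  slit e (segm (vec e%:C 0) v s).
Proof.
move=> e0 h s /andP[s0 s1]; rewrite /slit/= !segm_coord vec0 vec1 mulr0 add0r.
rewrite !ReD !ImD !ReMR !ImMR [Im e%:C]/= mulr0 add0r.
have [->|s_n0] := eqVneq s 0.
  by right; right; rewrite subr0 !mul0r mul1r addr0 /= -expr2.
case: h => [h|[h|h]]; [left|right;left|right;right].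
- by rewrite mulf_neq0// (inj_eq (@complexI _) s 0).
- by rewrite mulf_neq0.
have s1' : 0 <= 1 - s by rewrite subr_ge0.
have sgt : 0 < s by rewrite lt0r s_n0.
have := ltr_wpDl (mulr_ge0 s1' (ltW e0)) (mulr_gt0 sgt h).
by rewrite /= expr2 mulrDr mulrCA [e * (s * _)]mulrCA.
Qed.

Lemma coord_open (P : R[i] -> Prop) v i (d : R) : 0 < d ->
  (forall b, normc (b - v i 0) < d -> P b) ->
  exists2 d : R, 0 < d & forall w, nrm (w - v) < d -> P (w i 0).
Proof.
move=> d0 h; exists d => // w wv; apply: h; apply: le_lt_trans wv.
by have := coord_le_nrm (w - v) i; rewrite !mxE.
Qed.

Lemma neq0_open v : v != 0 -> exists2 d : R, 0 < d & forall w, nrm (w - v) < d -> w != 0.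
Proof.
move=> v0; exists (nrm v); first by rewrite nrm_gt0.
by move=> w; apply: contraTneq => ->; rewrite nrmB subr0 ltxx.
Qed.

Lemma slit_open (e : R) v : slit e v ->
  exists2 d : R, 0 < d & forall w, nrm (w - v) < d -> slit e w.
Proof.
case=> [h|[h|h]].
- have [||d d0 hd] := @coord_open (fun b => b != 0) v 1 (normc (v 1 0)).
  + by rewrite normc_gt0.
  + by move=> b; apply: contraTneq => ->; rewrite sub0r normcN ltxx.
  by exists d => // w /hd; left.
- have [||d d0 hd] := @coord_open (fun b => Im b != 0) v 0 `|Im (v 0 0)|.
  + by rewrite normr_gt0.
  + move=> b; apply: contraTneq => b0; rewrite -leNgt.
    by apply: le_trans (abs_Im_le _); rewrite raddfB/= b0 sub0r normrN.
  by exists d => // w /hd; right; left.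
have e0 : 0 < `|e| by rewrite normr_gt0; apply: contraTneq h => ->; rewrite mul0r ltxx.
have [||d d0 hd] := @coord_open (fun b => 0 < e * Re b) v 0 (e * Re (v 0 0) / `|e|).
+ by rewrite divr_gt0.
+ move=> b; rewrite ltr_pdivlMr// => hb.
  have := abs_Re_le (b - v 0 0); rewrite raddfB/= => /(fun h => ler_wpM2r (ltW e0) h).
  rewrite -normrM => /(le_lt_trans)/(_ hb).
  by rewrite ltr_norml; lra.
by exists d => // w /hd; right; right.
Qed.

Lemma slit_cover v : v != 0 -> slit 1 v \/ slit (-1) v.
Proof.
rewrite [v]vecE vec_eq0 /slit/= !vec0 !vec1 !mul1r !mulN1r.
have [v1|] := eqVneq (v 1 0) 0; last by left; left.
rewrite andbT; case: (v 0 0) => p q; rewrite eq_complex/= => h.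
have [q0|] := eqVneq q 0; last by left; right; left.
move: h; rewrite q0 eqxx andbT => /lt_total/orP[]p0.
  by right; right; right; rewrite oppr_gt0.
by left; right; right.
Qed.

(** C^2 without the real line of points (x, 0): the intersection of the two slit planes. *)
Definition axis_free : set V := [set v | v 1 0 != 0 \/ Im (v 0 0) != 0].

(** At most two segments lead from such a point to (i, 1): one coordinate moves while the other,
    which alone keeps the point off the real line, is fixed. *)
Lemma int_valued_axis_free F : (forall v, axis_free v -> rcont F v /\ F v \is a Num.int) ->
  forall v, axis_free v -> F v = F (vec 'i 1).
Proof.
move=> hF; have go a b c d : (b = d /\ b != 0) \/ (a = c /\ Im a != 0) ->
    F (vec a b) = F (vec c d).
  move=> h; apply: int_valued_segm => s _; apply: hF.
  rewrite /axis_free/= !segm_coord !vec0 !vec1.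
  have cc z : (1 - s)%:C * z + s%:C * z = z :> R[i].
    by rewrite -mulrDl -rmorphD subrK mul1r.
  by case: h => -[<- h]; rewrite cc; [left|right].
have i0 : Im ('i : R[i]) != 0 by rewrite oner_neq0.
move=> v; rewrite [v]vecE /axis_free/= vec0 vec1.
have [Im0|Im0 _] := eqVneq (Im (v 0 0)) 0.
  case=> // v1; rewrite (go _ _ 'i (v 1 0)); last by left.
  by rewrite (go _ _ 'i 1)//; right.
rewrite (go _ _ (v 0 0) 1); last by right.
by apply: go; left; rewrite oner_neq0.
Qed.

Lemma int_valued_punctured F : (forall v, v != 0 -> rcont F v /\ F v \is a Num.int) ->
  forall v, v != 0 -> F v = F (vec 1 1).
Proof.
move=> hF; have go a b c d : (b = d /\ b != 0) \/ (a = c /\ a != 0) ->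
    F (vec a b) = F (vec c d).
  move=> h; apply: int_valued_segm => s _; apply: hF.
  have cc z : (1 - s)%:C * z + s%:C * z = z :> R[i].
    by rewrite -mulrDl -rmorphD subrK mul1r.
  rewrite [segm _ _ _]vecE vec_eq0 !segm_coord !vec0 !vec1 negb_and.
  by case: h => -[<- h]; rewrite cc h ?orbT.
move=> v; rewrite [v]vecE vec_eq0 negb_and.
have [_ /= v1|v0 _] := eqVneq (v 0 0) 0.
  rewrite (go _ _ 1 (v 1 0)); last by left.
  by apply: go; right; rewrite oner_neq0.
rewrite (go _ _ (v 0 0) 1); last by right.
by apply: go; left; rewrite oner_neq0.
Qed.

(* The punctured plane is simply connected: it is the union of two starshaped slit
   planes with connected intersection. *)
Theorem punctured_lift T : (forall v, v != 0 -> locally_lifts T v) ->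
  exists F, forall v, v != 0 -> lifts T F v.
Proof.
move=> lT.
have sl e : e ^+ 2 = 1 -> exists F, forall v, slit e v -> lifts T F v.
  move=> e2; apply: (@starshaped_lift _ _ _ _ (vec e%:C 0)).
  - by move=> v hv s; apply: slit_star; rewrite ?e2.
  - exact: slit_open.
  move=> v hv; apply: lT; move: hv; rewrite [v]vecE vec_eq0 negb_and /slit/= vec0 vec1.
  case=> [->|[h|h]]; first by rewrite orbT.
    by apply/orP; left; apply: contraNneq h => ->.
  by apply/orP; left; apply: contraTneq h => ->; rewrite mulr0 ltxx.
have [F1 h1] := sl 1 (expr1n _ _).
have [F2 h2] : exists F, forall v, slit (-1) v -> lifts T F v.
  by apply: sl; rewrite sqrrN expr1n.
set m := F1 (vec 'i 1) - F2 (vec 'i 1).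
have F12 v : axis_free v -> F1 v = F2 v + m.
  move=> hv; apply/eqP; rewrite addrC -subr_eq; apply/eqP.
  apply: (@int_valued_axis_free (fun v => F1 v - F2 v)) hv => w hw.
  by apply: lifts_int; [apply: h1|apply: h2]; case: hw => hw; [left|right; left|left|right; left].
have mint : m \is a Num.int.
  have w0 : slit 1 (vec 'i 1 : V) by left; rewrite vec1 oner_neq0.
  have w1 : slit (-1) (vec 'i 1 : V) by left; rewrite vec1 oner_neq0.
  by case: (lifts_int (h1 _ w0) (h2 _ w1)).
(* Over [slit (-1)] this is [F2 v + m] throughout, by the choice of [m]. *)
pose F v := if `[< slit 1 v >] then F1 v else F2 v + m.
exists F => v v0.
have [s1|s1] := pselect (slit 1 v).
  have [d d0 hd] := slit_open s1.
  by apply: (lifts_near d0 _ (h1 _ s1)) => w /hd sw; rewrite /F; case: asboolP.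
have [//|s2] := slit_cover v0.
have [d d0 hd] := slit_open s2.
have lF2 : lifts T (fun w => F2 w + m) v.
  have [c2 i2] := h2 _ s2; split; first by apply: rcontD => //; exact: rcont_cst.
  by rewrite addrAC rpredD.
apply: (lifts_near d0 _ lF2) => w /hd sw; rewrite /F; case: asboolP => // s1w.
apply/esym/F12; case: sw => [|[]]; [by left|by right|].
case: s1w => [|[]]; [by left|by right|]; rewrite mul1r mulN1r; lra.
Qed.

End PlaneLifting.

(** * The covering of the Hopf surface *)

Section HopfTopology.
Context {R : realType} {alpha : R} (halpha : -1 < alpha < 0).
Local Notation V := 'cV[R[i]]_2.
Local Notation H := (Hopf halpha).
Implicit Types (v w : V) (n : int).

Lemma nbhs_nrmP v (A : set V) :
  nbhs v A <-> exists2 d : R, 0 < d & forall w, nrm (w - v) < d -> A w.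
Proof.
split => [/nbhs_ballP[e /= e0 h]|[d d0 h]].
  have eE : (Re e)%:C = e by apply: RRe_real; exact: gtr0_real.
  exists (Re e) => [|w wv]; first by rewrite -ltcR eE.
  by apply: h; rewrite -ball_normE/= -nrmB in wv *; rewrite nrmE -eE ltcR.
apply/nbhs_ballP; exists d%:C => /=; first by rewrite ltcR.
by move=> w; rewrite -ball_normE/= nrmE ltcR nrmB => /h.
Qed.

Lemma open_WP (O : set (W R)) : open O <->
  forall x, O x -> exists2 d : R, 0 < d & forall y : W R, nrm (val y - val x) < d -> O y.
Proof.
split=> [|h].
  move=> [A oA <-] x Ax.
  have /nbhs_nrmP[d d0 hd] : nbhs (val x) A by exact: open_nbhs_nbhs.
  by exists d => // y /hd.
exists [set v | exists2 x : W R, O x & exists2 d : R, nrm (v - val x) < d &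
  forall y : W R, nrm (val y - val x) < d -> O y].
  rewrite openE => v [x Ox [d vx hd]]; apply/nbhs_nrmP.
  exists (d - nrm (v - val x)) => [|w wv]; first by rewrite subr_gt0.
  exists x => //; exists d => //; rewrite (_ : w - val x = (w - v) + (v - val x)).
    by apply: le_lt_trans (nrmD _ _) _; rewrite -ltrBrDr.
  by rewrite addrA subrK.
apply/seteqP; split => [y [x Ox [d yx hd]]|x Ox]; first exact: hd.
by exists x => //; have [d d0 hd] := h _ Ox; exists d => //; rewrite subrr nrm0.
Qed.

Lemma e1_neq0 : vec 1 1 != 0 :> V.
Proof. by rewrite vec_eq0 negb_and oner_neq0. Qed.

(* [toW] and [vproj] are only meaningful away from [0]. *)
Definition toW v : W R :=
  if @idP (v != 0) is ReflectT h then mkW h else mkW e1_neq0.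

Definition vproj v : H := hopf_proj halpha (toW v).

Lemma val_toW v : v != 0 -> val (toW v) = v.
Proof. by rewrite /toW => h; case: {-}_ / idP => // /(_ h). Qed.

Lemma toW_val (x : W R) : toW (val x) = x.
Proof. by apply: val_inj; rewrite val_toW// W_neq0. Qed.

Lemma proj_val (x : W R) : vproj (val x) = hopf_proj halpha x.
Proof. by rewrite /vproj toW_val. Qed.

Lemma proj_surj (x : H) : exists2 v, v != 0 & vproj v = x.
Proof.
exists (val (repr x : W R)); first exact: W_neq0.
by rewrite proj_val /hopf_proj reprK.
Qed.

Lemma open_HopfP (D : set H) : open D <->
  forall v, v != 0 -> D (vproj v) -> exists2 d : R, 0 < d &
    forall w, nrm (w - v) < d -> w != 0 /\ D (vproj w).
Proof.
rewrite /open/= /quotient_open -/(open _) open_WP; split => h.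
  move=> v v0 Dv; have [d d0 hd] := h (toW v) Dv.
  have [d' d'0 hd'] := neq0_open v0.
  exists (Num.min d d') => [|w]; first by rewrite lt_min d0.
  rewrite lt_min => /andP[wd /hd' w0]; split => //.
  by apply: hd; rewrite !val_toW.
move=> x Dx; have [|d d0 hd] := h (val x) (W_neq0 x); first by rewrite proj_val.
by exists d => // y /hd[_]; rewrite proj_val.
Qed.

Local Notation al := (alpha%:C : R[i]).

Lemma al_neq0 : al != 0.
Proof. exact: alphaC_neq0 halpha. Qed.

Lemma alX_neq0 n : al ^ n != 0.
Proof. by rewrite expfz_neq0// al_neq0. Qed.

Lemma alZ_neq0 n v : (al ^ n *: v != 0) = (v != 0).
Proof. by rewrite scaler_eq0 (negbTE (alX_neq0 n)). Qed.

Lemma val_iter_hopf_f k (x : W R) : val (iter k (hopf_f halpha) x) = al ^+ k *: val x.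
Proof.
by elim: k => [|k IH]; rewrite ?expr0 ?scale1r// exprS -scalerA -IH.
Qed.

Lemma projP v w : v != 0 -> w != 0 ->
  vproj v = vproj w <-> exists n, w = al ^ n *: v.
Proof.
move=> v0 w0; rewrite /vproj hopf_projP; split => [[k hk]|[n hn]].
  case: hk => /(congr1 val); rewrite val_iter_hopf_f !val_toW// => hk.
    by exists k%:Z.
  exists (- k%:Z); rewrite hk scalerA -exprnN mulVf ?scale1r//.
  by rewrite expf_neq0// al_neq0.
case: n hn => k hk; [exists k; left|exists k.+1; right]; apply: val_inj;
  rewrite val_iter_hopf_f !val_toW//.
rewrite hk NegzE -exprnN scalerA mulfV ?scale1r//.
by rewrite expf_neq0// al_neq0.
Qed.

Lemma proj_alZ n v : v != 0 -> vproj (al ^ n *: v) = vproj v.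
Proof. by move=> v0; apply/esym/projP; rewrite ?alZ_neq0//; exists n. Qed.

Definition vlevel v : R := ln (nrm v) / ln `|alpha|.

Lemma ln_alpha_lt0 : ln `|alpha| < 0.
Proof.
have /andP[a1 a0] := halpha.
by rewrite ln_lt0// ltr0_norm//; lra.
Qed.

Lemma nrm_alZ n v : nrm (al ^ n *: v) = `|alpha| ^ n * nrm v.
Proof.
rewrite -fmorphXz nrmZR; congr (_ * _).
by case: n => k; rewrite ?NegzE -?exprnN -?exprnP ?normfV normrX.
Qed.

Lemma alpha_norm_gt0 : 0 < `|alpha|.
Proof. by rewrite normr_gt0; have /andP[_ /lt_eqF ->] := halpha. Qed.

Lemma ln_exprz (c : R) n : 0 < c -> ln (c ^ n) = n%:~R * ln c.
Proof.
move=> c0; case: n => k; rewrite ?NegzE.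
  by rewrite -exprnP lnXn// mulr_natl.
by rewrite -exprnN lnV ?posrE ?exprn_gt0// lnXn// mulrNz mulNr mulr_natl.
Qed.

Lemma level_alZ n v : v != 0 -> vlevel (al ^ n *: v) = vlevel v + n%:~R.
Proof.
move=> v0; rewrite /vlevel nrm_alZ lnM ?posrE ?exprz_gt0 ?alpha_norm_gt0 ?nrm_gt0//.
rewrite ln_exprz ?alpha_norm_gt0//.
by rewrite mulrDl mulfK ?lt_eqF ?ln_alpha_lt0// addrC.
Qed.

Lemma alX_inj n m : al ^ n = al ^ m -> n = m.
Proof.
move=> h; have := level_alZ n e1_neq0; rewrite h level_alZ ?e1_neq0// => /addrI.
by move/intr_inj.
Qed.

Lemma rcont_level v : v != 0 -> rcont vlevel v.
Proof.
move=> v0 e e0.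
have vgt : 0 < nrm v by rewrite nrm_gt0.
have e1 : 0 < e * `|ln `|alpha| | by rewrite mulr_gt0// normr_gt0 lt_eqF// ln_alpha_lt0.
have := continuous_ln vgt => /cvgrPdist_lt/(_ _ e1)/nbhs_ballP[d /= d0 h].
exists d => // w wv; rewrite /vlevel -mulrBl normrM normfV ltr_pdivrMr; last first.
  by rewrite normr_gt0 lt_eqF// ln_alpha_lt0.
rewrite distrC; apply: h; rewrite /ball/=; apply: le_lt_trans wv.
rewrite ler_norml; have := nrmD (w - v) v; have := nrmD (v - w) w.
by rewrite !subrK (nrmB v); lra.
Qed.

End HopfTopology.

(** * Differentiability with real error bounds *)

Section Differentiability.
Context {R : realType} {U V : normedModType R[i]}.
Implicit Types (F : U -> V) (v w h : U).

Lemma differentiable_nrmP F v : differentiable F v <->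
  exists2 L : {linear U -> V}, continuous L & forall e : R, 0 < e ->
    exists2 d : R, 0 < d & forall w, nrm (w - v) < d ->
      nrm (F w - F v - L (w - v)) <= e * nrm (w - v).
Proof.
have eps (L : {linear U -> V}) :
    F \o shift v = cst (F v) + L +o_ 0 id <-> forall e : R, 0 < e ->
    exists2 d : R, 0 < d & forall w, nrm (w - v) < d ->
      nrm (F w - F v - L (w - v)) <= e * nrm (w - v).
  split.
    move=> /eqaddoP h e e0; have e0' : 0 < e%:C by rewrite ltcR.
    have /nbhs_ballP[d /= d0 hd] := h _ e0'.
    have dE : (Re d)%:C = d by apply: RRe_real; exact: gtr0_real.
    exists (Re d) => [|w wv]; first by rewrite -ltcR dE.
    have : ball (0 : U) d (w - v) by rewrite -ball_normE/= sub0r normrN nrmE -dE ltcR.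
    move=> /hd; rewrite /= !fctE /= subrK !nrmE -rmorphM lecR.
    by rewrite opprD addrA.
  move=> h; apply/eqaddoP => e e0.
  have eE : (Re e)%:C = e by apply: RRe_real; exact: gtr0_real.
  have [|d d0 hd] := h (Re e); first by rewrite -ltcR eE.
  apply/nbhs_ballP; exists d%:C => /=; first by rewrite ltcR.
  move=> w hw; have wd : nrm w < d.
    by move: hw; rewrite -ball_normE/= sub0r normrN nrmE ltcR.
  rewrite -eE !nrmE -rmorphM lecR !fctE /= opprD addrA.
  by have := hd (w + v); rewrite addrK; apply.
split=> [/diff_locallyP[cd h]|[L cL /eps h]].
  by exists ('d F v) => //; apply/eps.
by apply/diff_locallyP; rewrite (diff_unique cL h).
Qed.

Lemma near_eq_differentiable F (G : U -> V) v (d : R) : 0 < d ->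
  (forall w, nrm (w - v) < d -> F w = G w) -> differentiable F v -> differentiable G v.
Proof.
move=> d0 FG /differentiable_nrmP[L cL h]; apply/differentiable_nrmP; exists L => // e e0.
have [d' d'0 hd] := h _ e0; exists (Num.min d d') => [|w]; first by rewrite lt_min d0.
rewrite lt_min => /andP[wd /hd]; rewrite FG// [F v]FG//.
by rewrite subrr nrm0.
Qed.

Definition vcont F v := forall e : R, 0 < e -> exists2 d : R, 0 < d &
  forall w, nrm (w - v) < d -> nrm (F w - F v) < e.

Lemma differentiable_vcont F v : differentiable F v -> vcont F v.
Proof.
move=> /differentiable_continuous cF e e0; have e0' : 0 < e%:C by rewrite ltcR.
move/(@cvgr_dist_lt _ _ _ (nbhs v)): cF => /(_ _ e0') /nbhs_ballP[d /= d0 h].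
have dE : (Re d)%:C = d by apply: RRe_real; exact: gtr0_real.
exists (Re d) => [|w wv]; first by rewrite -ltcR dE.
have : ball v d w by rewrite -ball_normE/= nrmE -dE ltcR nrmB.
by move=> /h; rewrite nrmE ltcR nrmB.
Qed.

Lemma rcont_comp (f : V -> R) F v : rcont f (F v) -> vcont F v -> rcont (fun w => f (F w)) v.
Proof.
move=> hf hF e /hf[d /hF[d' d'0 h] hd]; exists d' => // w /h; exact: hd.
Qed.

End Differentiability.

(** * Charts as local inverses of the projection *)

Section HopfCovering.
Context {R : realType} {alpha : R} (halpha : -1 < alpha < 0).
Local Notation V := 'cV[R[i]]_2.
Local Notation H := (Hopf halpha).
Local Notation al := (alpha%:C : R[i]).
Local Notation proj := (vproj halpha).
Local Notation level := (@vlevel R alpha).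
Implicit Types (v w : V) (n : int) (D : set H) (c : H -> V).

Lemma level_eq v w : v != 0 -> w != 0 -> proj v = proj w ->
  `|level v - level w| < 1 -> v = w.
Proof.
move=> v0 w0 /projP[]// n -> ; rewrite level_alZ// opprD addrA subrr sub0r normrN.
move=> h; have n1 : `|n| < 1 by rewrite -(ltr_int R) intr_norm.
have -> : n = 0 by move: n1; rewrite ltr_norml; lia.
by rewrite expr0z scale1r.
Qed.

(** Continuity of the section is kept only through its level: x determines the point c x up to a
    power of alpha, and the level fixes that power. *)
Lemma atlasP D c : hopf_atlas (D, c) ->
  [/\ open D, forall x, D x -> c x != 0, forall x, D x -> proj (c x) = x &
      forall x (e : R), D x -> 0 < e -> exists N, [/\ open N, N x &
        forall y, N y -> `|level (c y) - level (c x)| < e]].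
Proof.
move=> [/= oD [s [cs sK cE]]]; subst c; split => // [x _|x Dx|x e Dx e0]; first exact: W_neq0.
  by rewrite proj_val sK// inE.
have [d d0 hd] := rcont_level halpha (W_neq0 (s x)) e0.
pose O := [set y : W R | nrm (val y - val (s x)) < d].
have oO : open O.
  apply/open_WP => y Oy; exists (d - nrm (val y - val (s x))); first by rewrite subr_gt0.
  move=> z zy; rewrite /O/= (_ : _ - _ = (val z - val y) + (val y - val (s x))).
    by apply: le_lt_trans (nrmD _ _) _; rewrite -ltrBrDr.
  by rewrite addrA subrK.
move: cs; rewrite continuous_open_subspace// => /(_ x); rewrite inE => /(_ Dx) cs.
have : nbhs (s x) O.
  by apply: open_nbhs_nbhs; split=> //; rewrite /O/= subrr nrm0.
move=> /cs; rewrite nbhsE => -[N [oN Nx] NO].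
by exists N; split => // y /NO; exact: hd.
Qed.

(** The exponent n is read off at v. It stays the same nearby because the levels of [c (proj w)] and
    of [al ^ n *: w] each move by less than 1 / 2. *)
Lemma chart_proj D c v : hopf_atlas (D, c) -> v != 0 -> D (proj v) ->
  exists n, exists2 d : R, 0 < d & forall w, nrm (w - v) < d ->
    [/\ w != 0, D (proj w) & c (proj w) = al ^ n *: w].
Proof.
move=> /atlasP[oD c0 cK cc] v0 Dv.
have [n hn] : exists n, c (proj v) = al ^ n *: v.
  by apply/projP => //; [exact: c0|rewrite cK].
exists n.
have h2 : 0 < 1 / 2 :> R by lra.
have [d1 d10 h1] := (open_HopfP D).1 oD _ v0 Dv.
have [N [oN Nv h3]] := cc _ _ Dv h2.
have [d3 d30 hd3] := (open_HopfP N).1 oN _ v0 Nv.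
have [d4 d40 h4] := rcont_level halpha v0 h2.
exists (Num.min d1 (Num.min d3 d4)) => [|w]; first by rewrite !lt_min d10 d30.
rewrite !lt_min => /and3P[/h1[w0 Dw] /hd3[_ /h3 wd3] wd4]; split => //.
apply: level_eq; rewrite ?c0 ?alZ_neq0 ?cK ?proj_alZ//.
rewrite hn in wd3.
have := h4 _ wd4; move: wd3; rewrite !level_alZ// !ltr_norml; lra.
Qed.

(** The projection is injective on the shell of points whose level is within 1 / 2 of that of v; the
    section is its inverse there. *)
Lemma local_section v : v != 0 -> exists D, exists2 c, hopf_atlas (D, c) &
  D (proj v) /\ c (proj v) = v.
Proof.
move=> v0.
pose B w := w != 0 /\ `|level w - level v| < 1 / 2.
have Beq w w' : B w -> B w' -> proj w = proj w' -> w = w'.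
  move=> [w0 bw] [w'0 bw'] ww'; apply: level_eq => //; move: bw bw'.
  by rewrite !ltr_norml; lra.
have Bopen w : B w -> exists2 d : R, 0 < d & forall w', nrm (w' - w) < d -> B w'.
  move=> [w0 bw]; have [d d0 hd] := neq0_open w0.
  have e0 : 0 < 1 / 2 - `|level w - level v| by rewrite subr_gt0.
  have [d' d'0 hd'] := rcont_level halpha w0 e0.
  exists (Num.min d d') => [|w']; first by rewrite lt_min d0.
  rewrite lt_min => /andP[/hd w'0 /hd' h]; split => //.
  rewrite -(subrKA (level w)); apply: le_lt_trans (ler_normD _ _) _.
  by rewrite -ltrBrDr.
pose D : set H := [set x | exists2 w, B w & proj w = x].
have /choice[s hs] : forall x, exists y : W R, D x -> B (val y) /\ proj (val y) = x.
  move=> x; have [[w Bw <-]|nD] := pselect (D x).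
    by exists (toW w) => _; rewrite val_toW//; case: Bw.
  by exists (toW v) => /nD.
pose c x := val (s x).
have hc x : D x -> B (c x) /\ proj (c x) = x by exact: hs.
have cE w : B w -> c (proj w) = w.
  by move=> Bw; have [|Bc /Beq->//] := hc (proj w); exists w.
(* A condition near [c (proj u)] is brought back to u by the deck transformation relating the two
   points, with the radius rescaled accordingly. *)
have Dnear u (O : set V) : u != 0 -> D (proj u) ->
    (exists2 d : R, 0 < d & forall w, nrm (w - c (proj u)) < d -> O w) ->
    exists2 d : R, 0 < d & forall w, nrm (w - u) < d ->
      [/\ w != 0, D (proj w) & O (c (proj w))].
  move=> u0 Du [d d0 hd]; have [Bc cu] := hc _ Du.
  have [d' d'0 hd'] := Bopen _ Bc.
  have [n hn] : exists n, c (proj u) = al ^ n *: u.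
    by apply/(projP halpha) => //; case: Bc.
  have an : 0 < `|alpha| ^ n by rewrite exprz_gt0// (alpha_norm_gt0 halpha).
  exists (Num.min d d' / `|alpha| ^ n) => [|w]; first by rewrite divr_gt0// lt_min d0.
  rewrite ltr_pdivlMr// mulrC -nrm_alZ scalerBr -hn lt_min => /andP[/hd Ow /hd' Bw].
  have w0 : w != 0 by rewrite -(alZ_neq0 halpha n); case: Bw.
  rewrite -(proj_alZ halpha n w0) cE//; split => //; by exists (al ^ n *: w).
have oD : open D.
  apply/open_HopfP => u u0 Du; have [|d d0 hd] := Dnear u setT u0 Du; first by exists 1.
  by exists d => // w /hd[].
have Bv : B v by split => //; rewrite subrr normr0.
exists D; exists c; last by split; [exists v|rewrite cE].
split => //; exists s; split => //; last first.
  by move=> x; rewrite inE => /hc[_]; rewrite proj_val.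
rewrite continuous_open_subspace// => x; rewrite inE => Dx A.
rewrite nbhsE => -[Q [oQ Qx] QA].
pose N := [set y | D y /\ Q (s y)].
have oN : open N.
  apply/open_HopfP => u u0 [Du /((open_WP Q).1 oQ)[d d0 hd]].
  have [|d' d'0 hd'] := Dnear u [set w | Q (toW w)] u0 Du.
    exists (Num.min d (nrm (c (proj u)))) => [|w].
      by rewrite lt_min d0 nrm_gt0; case: (hc _ Du) => -[].
    rewrite lt_min => /andP[wd wn].
    have w0 : w != 0 by apply: contraTneq wn => ->; rewrite nrmB subr0 ltxx.
    by apply: hd; rewrite val_toW.
  exists d' => // w /hd'[w0 Dw]; rewrite /= toW_val => Qw; split => //.
have : nbhs x N by apply: open_nbhs_nbhs.
by apply: filterS => y [_ /QA].
Qed.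

End HopfCovering.

(** * Lifts of maps of the Hopf surface *)

Section HopfLift.
Context {R : realType} {alpha : R} (halpha : -1 < alpha < 0).
Local Notation V := 'cV[R[i]]_2.
Local Notation H := (Hopf halpha).
Local Notation al := (alpha%:C : R[i]).
Local Notation proj := (vproj halpha).
Local Notation level := (@vlevel R alpha).
Implicit Types (v w : V) (n : int) (D : set H) (c : H -> V) (phi : H -> H) (F G : V -> V).

Lemma pinv_chart D c x v : hopf_atlas (D, c) -> v != 0 -> D (proj v) -> c (proj v) = v ->
  exists2 d : R, 0 < d & forall w, nrm (w - v) < d ->
    [/\ w != 0, D (proj w), c (proj w) = w & 'pinv_(fun=> x) D c w = proj w].
Proof.
move=> Dc v0 Dv cv; have [n [d d0 hd]] := chart_proj Dc v0 Dv.
have [_ _ cK _] := atlasP Dc.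
have n0 : n = 0.
  have := hd v; rewrite subrr nrm0 => /(_ d0)[_ _]; rewrite cv => /(congr1 level).
  rewrite level_alZ// => /eqP; rewrite -subr_eq0 opprD addrA subrr sub0r oppr_eq0 intr_eq0.
  by move/eqP.
exists d => // w /hd[w0 Dw]; rewrite n0 expr0z scale1r => cw; split => //.
have cinj : {in D &, injective c}.
  by move=> y z; rewrite !inE => /cK {2}<- /cK {2}<- ->.
by rewrite -{1}cw pinvKV// inE.
Qed.

(** In charts phi reads [al ^ n *: F], with n depending on the chart of the target, and not F
    itself; hence the second hypothesis. *)
Lemma induced_holomorphic phi F :
  (forall v, v != 0 -> [/\ F v != 0, phi (proj v) = proj (F v) & differentiable F v]) ->
  (forall n v, v != 0 -> differentiable (fun w => al ^ n *: F w) v) ->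
  holomorphic_map (@hopf_atlas _ _ halpha) phi.
Proof.
move=> hF hFn; split.
  apply/continuousP => D oD; apply/open_HopfP => v v0 /= Dv.
  have [F0 pF dF] := hF _ v0; rewrite pF in Dv.
  have [d d0 hd] := (open_HopfP D).1 oD _ F0 Dv.
  have [d' d'0 hd'] := differentiable_vcont dF d0.
  have [d2 d20 hd2] := neq0_open v0.
  exists (Num.min d' d2) => [|w]; first by rewrite lt_min d'0.
  rewrite lt_min => /andP[/hd'/hd[_ DF] /hd2 w0]; split => //=.
  by have [_ -> _] := hF _ w0.
move=> D D' c c' Dc Dc' x Dx D'x.
have [_ c0 cK _] := atlasP Dc.
have v0 := c0 _ Dx; have px := cK _ Dx; set v := c x in v0 px *.
have [F0 pF dF] := hF _ v0.
rewrite -px pF in D'x.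
have [n [d d0 hd]] := chart_proj Dc' F0 D'x.
have [d' d'0 hd'] := differentiable_vcont dF d0.
have [||d2 d20 hd2] := @pinv_chart D c x v Dc v0; rewrite ?px//.
apply: (@near_eq_differentiable _ _ _ (fun w => al ^ n *: F w) _ _ (Num.min d' d2)).
- by rewrite lt_min d'0.
- move=> w; rewrite lt_min => /andP[/hd'/hd[_ _ cw] /hd2[w0 _ _ pw]].
  by rewrite /= pw; have [_ -> _] := hF _ w0.
- exact: hFn.
Qed.

(** [u] picks points above the values of phi without any continuity, but modulo Z the level of these
    points does not depend on the choice, and charts lift it locally. A global lift [tau] of it
    selects [F v] as the point above [phi (proj v)] at level [tau v]. *)
Lemma hopf_lift phi : holomorphic_map (@hopf_atlas _ _ halpha) phi ->
  exists F, forall v, v != 0 -> [/\ F v != 0, proj (F v) = phi (proj v) & differentiable F v].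
Proof.
move=> [cphi hphi].
have /choice[u hu] : forall x : H, exists v, v != 0 /\ proj v = x.
  by move=> x; have [v v0 vx] := proj_surj x; exists v.
pose T v := level (u (phi (proj v))).
have shift v w : v != 0 -> w != 0 -> proj v = proj w -> level v - level w \is a Num.int.
  move=> v0 w0 /(projP _ v0 w0)[n ->]; rewrite level_alZ// opprD addrA subrr sub0r rpredN.
  exact: intr_int.
have lcont D c y : hopf_atlas (D, c) -> y != 0 -> D (phi (proj y)) ->
    rcont (fun w => level (c (phi (proj w)))) y.
  move=> Dc y0 Dy e e0; have [_ _ _ cc] := atlasP Dc.
  have [N [oN Ny hN]] := cc _ _ Dy e0.
  have oN' : open (phi @^-1` N) by move/continuousP: cphi; apply.
  have [d d0 hd] := (open_HopfP _).1 oN' _ y0 Ny.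
  by exists d => // w /hd[_ /hN].
have lT v : v != 0 -> locally_lifts T v.
  move=> v0; have [u0 pu] := hu (phi (proj v)).
  have [D [c Dc [Du _]]] := local_section halpha u0.
  have [oD c0 cK _] := atlasP Dc.
  have oD' : open (phi @^-1` D) by move/continuousP: cphi; apply.
  rewrite pu in Du.
  have [d d0 hd] := (open_HopfP _).1 oD' _ v0 Du.
  exists (fun w => level (c (phi (proj w)))); exists d => // w /hd[w0 Dw].
  split; first exact: lcont Dc w0 Dw.
  have [u'0 pu'] := hu (phi (proj w)).
  by apply: shift; rewrite ?c0// cK.
have [tau htau] := punctured_lift lT.
have /choice[F hF] : forall v, exists w, v != 0 ->
    [/\ w != 0, proj w = phi (proj v) & level w = tau v].
  move=> v; have [v0|] := boolP (v != 0); last by exists 0.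
  have [_ /intrP[n hn]] := htau _ v0; have [u0 pu] := hu (phi (proj v)).
  exists (al ^ n *: u (phi (proj v))) => _; split.
  - by rewrite (alZ_neq0 halpha).
  - by rewrite -[RHS]pu; exact: proj_alZ.
  - by rewrite (level_alZ halpha)// -hn /T addrC subrK.
exists F => v v0; have [F0 pF lF] := hF _ v0; split => //.
have [D' [c' Dc' [D'F cF]]] := local_section halpha F0.
have [oD' c'0 c'K _] := atlasP Dc'.
have [D [c Dc [Dv cv]]] := local_section halpha v0.
have [d d0 hd] := pinv_chart (proj v) Dc v0 Dv cv.
have D'v : D' (phi (proj v)) by rewrite -pF.
have := hphi D D' c c' Dc Dc' (proj v) Dv D'v; rewrite cv => dphi.
have h2 : 0 < 1 / 2 :> R by lra.
have [d1 d10 h1] := lcont _ _ _ Dc' v0 D'v _ h2.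
have [d3 d30 h3] := (htau _ v0).1 _ h2.
have oD'' : open (phi @^-1` D') by move/continuousP: cphi; apply.
have [d4 d40 h4] := (open_HopfP _).1 oD'' _ v0 D'v.
pose d5 := Num.min (Num.min d d1) (Num.min d3 d4).
(* Near v, F equals the coordinate expression of phi: both lie above the same point, and each level
   moves by less than 1 / 2. *)
apply: (@near_eq_differentiable _ _ _ _ _ _ d5 _ _ dphi) => [|w].
  by rewrite /d5 !lt_min d0 d10 d30.
rewrite /d5 !lt_min => /andP[/andP[/hd[w0 _ _ pw] /h1 hw1] /andP[/h3 hw3 /h4[_ D'w]]].
have [Fw0 pFw lFw] := hF _ w0.
rewrite /= pw; apply: (level_eq (halpha := halpha)); rewrite ?c'0 ?c'K ?pFw//.
move: hw1 hw3; rewrite lFw -pF cF lF !ltr_norml; lra.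
Qed.

(* Two lifts differ by a deck transformation, constant since the plane is connected. *)
Lemma lift_unique F G :
  (forall v, v != 0 -> [/\ F v != 0, G v != 0, proj (F v) = proj (G v), vcont F v & vcont G v]) ->
  exists n, forall v, v != 0 -> G v = al ^ n *: F v.
Proof.
move=> h.
have hn v : v != 0 -> exists n, G v = al ^ n *: F v.
  by move=> v0; have [F0 G0 FG _ _] := h _ v0; apply/projP.
have hI v : v != 0 -> rcont (fun v => level (G v) - level (F v)) v /\
    level (G v) - level (F v) \is a Num.int.
  move=> v0; have [F0 G0 FG cF cG] := h _ v0; split.
    apply: rcontD; first by apply: rcont_comp => //; exact: rcont_level halpha _ _.
    by apply: rcontN; apply: rcont_comp => //; exact: rcont_level halpha _ _.
  have [n ->] := hn _ v0; rewrite level_alZ// addrAC subrr add0r; exact: intr_int.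
have e1 : vec 1 1 != 0 :> V by exact: e1_neq0.
have [n n1] := hn _ e1; exists n => v v0; have [m mv] := hn _ v0; rewrite mv.
have := int_valued_punctured hI v0.
have [F0 _ _ _ _] := h _ v0; have [F10 _ _ _ _] := h _ e1.
rewrite mv n1 !level_alZ// ![_ + _ - _]addrAC !subrr !add0r => /intr_inj -> //.
Qed.

End HopfLift.

(** * Equivariant holomorphic self-maps of the punctured plane *)

Section Equivariance.
Context {R : realType} {alpha : R} (halpha : -1 < alpha < 0).
Local Notation V := 'cV[R[i]]_2.
Local Notation al := (alpha%:C : R[i]).
Local Notation level := (@vlevel R alpha).
Implicit Types (v w p q : V) (F : V -> V).

(** Real coordinates on C^2: compactness of closed bounded sets is applied in R^4, whose norm agrees
    with [nrm] up to a factor 4. *)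
Let iota (x : 'rV[R]_4) : V :=
  vec (x 0 (inord 0) +i* x 0 (inord 1)) (x 0 (inord 2) +i* x 0 (inord 3)).

Let iotaB x y : iota x - iota y = iota (x - y).
Proof. by apply: cV2P; rewrite /iota !mxE. Qed.

Let nrm_iota_le x : nrm (iota x) <= 4 * `|x|.
Proof.
have cx i : `|x 0 i| <= `|x|.
  rewrite [leRHS]/Num.Def.normr/= mx_normrE.
  exact: (@le_bigmax _ _ _ _ (fun i : 'I_1 * 'I_4 => `|x i.1 i.2|) (0, i)).
apply: le_trans (nrm_le_coord _) _; rewrite vec0 vec1.
apply: le_trans (lerD (normc_le_Re_Im _) (normc_le_Re_Im _)) _ => /=.
have := cx (inord 0); have := cx (inord 1); have := cx (inord 2); have := cx (inord 3).
lra.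
Qed.

Let norm_le_iota x : `|x| <= nrm (iota x).
Proof.
rewrite [leLHS]/Num.Def.normr/= mx_normrE.
apply: bigmax_le; first exact: nrm_ge0.
move=> [i j] _ /=; rewrite (ord1 i) {i}.
have := coord_le_nrm (iota x) 0; have := coord_le_nrm (iota x) 1; rewrite vec0 vec1.
move=> h1 h0.
case: j => [[|[|[|[|//]]]]] hj.
- rewrite (_ : Ordinal hj = inord 0); first exact: le_trans (abs_Re_le _) h0.
  by apply: val_inj; rewrite /= inordK.
- rewrite (_ : Ordinal hj = inord 1); first exact: le_trans (abs_Im_le _) h0.
  by apply: val_inj; rewrite /= inordK.
- rewrite (_ : Ordinal hj = inord 2); first exact: le_trans (abs_Re_le _) h1.
  by apply: val_inj; rewrite /= inordK.
- rewrite (_ : Ordinal hj = inord 3); first exact: le_trans (abs_Im_le _) h1.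
  by apply: val_inj; rewrite /= inordK.
Qed.

Let iota_surj v : exists x, iota x = v.
Proof.
pose f (j : 'I_4) := nth 0 [:: Re (v 0 0); Im (v 0 0); Re (v 1 0); Im (v 1 0)] j.
exists (\row_j f j); apply: cV2P; rewrite ?vec0 ?vec1 !mxE /f !inordK//=.
  by case: (v 0 0).
by case: (v 1 0).
Qed.

Lemma invariant_bounded (f : V -> R) :
  (forall v, v != 0 -> rcont f v) ->
  (forall n v, v != 0 -> f (al ^ n *: v) = f v) ->
  exists C, forall v, v != 0 -> f v <= C.
Proof.
move=> cf finv.
have a0 := alpha_norm_gt0 halpha.
(* The lower bound is divided by 4 because [nrm_iota_le] loses this factor. *)
pose K := [set x : 'rV[R]_4 | `|alpha| / 4 <= `|x| <= 1].
have Kbounded : bounded_set K.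
  by exists 1; split => // M M1 x /andP[_ /le_trans]; apply; exact: ltW.
have Kclosed : closed K.
  rewrite (_ : K = (fun x : 'rV[R]_4 => `|x|) @^-1` `[`|alpha| / 4, 1]%classic).
    have /continuous_closedP := @norm_continuous R 'rV[R]_4.
    by apply; exact: itv_closed.
  by apply/seteqP; split => x; rewrite /K/= in_itv.
have cK := bounded_closed_compact Kbounded Kclosed.
have K0 x : K x -> iota x != 0.
  move=> /andP[x1 _]; rewrite -nrm_gt0; apply: lt_le_trans (norm_le_iota x).
  by apply: lt_le_trans x1; lra.
have cfi : {within K, continuous (f \o iota)}.
  apply: continuous_in_subspaceT => x; rewrite inE => Kx.
  apply/(@cvgrPdist_lt _ _ _ (nbhs x)) => e e0; have [d d0 hd] := cf _ (K0 _ Kx) _ e0.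
  have d40 : 0 < d / 4 by lra.
  near=> y; rewrite distrC; apply: hd; rewrite iotaB.
  apply: le_lt_trans (nrm_iota_le _) _.
  have : `|x - y| < d / 4 by near: y; apply: cvgr_dist_lt => //; exact: cvg_id.
  rewrite distrC; lra.
have inK v : v != 0 -> exists n x, K x /\ iota x = al ^ n *: v.
  (* This power brings the level into [0, 1), that is the norm into (|alpha|, 1]. *)
  move=> v0; pose n := - Num.floor (level v); exists n.
  have w0 : al ^ n *: v != 0 by rewrite (alZ_neq0 halpha).
  have [x xv] := iota_surj (al ^ n *: v); exists x; split => //.
  have lw := level_alZ halpha n v0.
  have /andP[f0 f1] := real_floor_itv (num_real (level v)).
  rewrite rmorphD/= in f1.
  have nE : n%:~R = - (Num.floor (level v))%:~R :> R by rewrite mulrNz.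
  have lna := ln_alpha_lt0 halpha.
  have nw : 0 < nrm (al ^ n *: v) by rewrite nrm_gt0.
  have lnE : ln (nrm (al ^ n *: v)) = level (al ^ n *: v) * ln `|alpha|.
    by rewrite /level divfK// lt_eqF.
  have n1 : nrm (al ^ n *: v) <= 1.
    rewrite -ler_ln ?posrE// ln1 lnE mulr_ge0_le0//; last exact: ltW.
    by rewrite lw nE; lra.
  have na : `|alpha| <= nrm (al ^ n *: v).
    rewrite -ler_ln ?posrE// lnE -[leLHS]mul1r ler_wnM2r//; first exact: ltW.
    by rewrite lw nE; lra.
  rewrite -xv in n1 na; apply/andP; split; last exact: le_trans (norm_le_iota _) n1.
  have := nrm_iota_le x; lra.
have K_0 : K !=set0 by have [n [x [Kx _]]] := inK _ e1_neq0; exists x.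
have [x _ hx] := compact_EVT_max K_0 cK cfi.
exists (f (iota x)) => v v0; have [n [y [Ky yv]]] := inK _ v0.
by rewrite -(finv n)// -yv; apply: hx; rewrite inE.
Unshelve. all: by end_near. Qed.

Lemma alX_small (d : R) : 0 < d -> exists n : nat, `|alpha| ^+ n < d.
Proof.
move=> d0.
have : geometric 1 `|alpha| @ \oo --> (0 : R).
  apply: cvg_geometric; rewrite normr_id ltr0_norm; by have /andP[] := halpha; lra.
move=> /cvgrPdist_lt/(_ _ d0)[n _ h]; exists n.
have := h n; rewrite /= => /(_ (leqnn n)); rewrite /geometric/= mul1r sub0r normrN normrX normr_id.
by [].
Qed.

(** The determinant with columns p and q. It is unchanged when p moves along p + z q, so a nonzero
    value keeps this line off the origin. *)
Definition cdet p q : R[i] := p 0 0 * q 1 0 - p 1 0 * q 0 0.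

Lemma cdet_line p q z : cdet p q = cdet (p + z *: q) q.
Proof. by rewrite /cdet !mxE; ring. Qed.

Lemma cdet_line_neq0 p q z : cdet p q != 0 -> p + z *: q != 0.
Proof.
rewrite (cdet_line p q z); apply: contraNneq => ->.
by rewrite /cdet !mxE !mul0r subrr.
Qed.

(** This bounds the distance from the line to the origin from below, so that a map of size at most M
    / |v| is bounded on the line. *)
Lemma cdet_line_bound p q z : normc (cdet p q) <= 2 * nrm q * nrm (p + z *: q).
Proof.
rewrite (cdet_line p q z) /cdet.
apply: le_trans (normc_leD _ _) _; rewrite normcN !normcM.
have h (a b : R) c d : 0 <= a -> 0 <= b -> a <= c -> b <= d -> a * b <= c * d.
  by move=> *; exact: ler_pM.
have := h _ _ _ _ (normc_ge0 _) (normc_ge0 _) (coord_le_nrm (p + z *: q) 0) (coord_le_nrm q 1).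
have := h _ _ _ _ (normc_ge0 _) (normc_ge0 _) (coord_le_nrm (p + z *: q) 1) (coord_le_nrm q 0).
lra.
Qed.

Lemma line_affine F p q (K : R) :
  (forall v, v != 0 -> differentiable F v) -> cdet p q != 0 ->
  (forall z, nrm (F (p + z *: q)) <= K * (1 + normc z)) ->
  forall z, F (p + z *: q) = F p + z *: (F (p + q) - F p).
Proof.
move=> dF pq hK z.
have coord i : F (p + z *: q) i 0 = F p i 0 + z * (F (p + q) i 0 - F p i 0).
  pose g z := F (p + z *: q) i 0.
  have := @linear_growth_affine _ g K _ _ z; rewrite /g scale0r addr0 scale1r; apply.
    move=> w; have /differentiable_nrmP[L _ hL] := dF _ (cdet_line_neq0 w pq).
    exists (L q i 0) => e e0; have nq := nrm_ge0 q.
    have [|d d0 hd] := hL (e / (1 + nrm q)); first by rewrite divr_gt0//; lra.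
    exists (d / (1 + nrm q)) => [|w']; first by rewrite divr_gt0//; lra.
    have w'E : p + w' *: q - (p + w *: q) = (w' - w) *: q.
      by rewrite opprD addrACA subrr add0r scalerBl.
    have nw := normc_ge0 (w' - w).
    have D0 : 0 < 1 + nrm q by lra.
    rewrite ltr_pdivlMr// => hw.
    have hq : normc (w' - w) * nrm q < d by lra.
    have := hd (p + w' *: q); rewrite w'E nrmZ => /(_ hq) h.
    have := coord_le_nrm (F (p + w' *: q) - F (p + w *: q) - L ((w' - w) *: q)) i.
    rewrite linearZ !mxE [_ * (w' - w)]mulrC => /le_trans; apply.
    move: h; rewrite linearZ => /le_trans; apply.
    rewrite mulrAC ler_pdivrMr// mulrA ler_wpM2l; first by []. 
      by rewrite mulr_ge0// ltW.
    lra.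
  by move=> w; apply: le_trans (hK w); exact: coord_le_nrm.
by apply: cV2P; rewrite coord !mxE.
Qed.

End Equivariance.

(** * Linearity for k = 1, absurdity for k = -1 *)

Section EquivariantMaps.
Context {R : realType} {alpha : R} (halpha : -1 < alpha < 0).
Local Notation V := 'cV[R[i]]_2.
Local Notation al := (alpha%:C : R[i]).
Local Notation level := (@vlevel R alpha).
Implicit Types (v w p q : V) (F : V -> V) (k : int).

(** [k * level v - level (F v)] is invariant under deck transformations, hence bounded above; since
    ln |alpha| is negative, exponentiating gives an upper bound on [nrm (F v)]. *)
Lemma equivariant_growth F k :
  (forall v, v != 0 -> F v != 0) -> (forall v, v != 0 -> differentiable F v) ->
  (forall n v, v != 0 -> F (al ^ n *: v) = al ^ (k * n) *: F v) ->
  exists2 M, 0 <= M & forall v, v != 0 -> nrm (F v) <= M * nrm v ^ k.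
Proof.
move=> F0 dF Fal.
have [||C hC] := @invariant_bounded _ _ halpha (fun v => k%:~R * level v + - level (F v)).
- move=> v v0; apply: rcontD.
    move=> e e0; have [|d d0 hd] := rcont_level halpha v0 (e := e / (1 + `|k%:~R|)).
      by rewrite divr_gt0// ltr_wpDr.
    exists d => // w /hd; rewrite ltr_pdivlMr ?ltr_wpDr// -mulrBr normrM.
    have := normr_ge0 (level w - level v); lra.
  apply: rcontN; apply: (rcont_comp (f := level)); first exact: rcont_level halpha _ (F0 _ v0).
  exact/differentiable_vcont/dF.
- move=> n v v0; rewrite Fal// !(level_alZ halpha) ?F0// intrM; ring.
exists (expR (- C * ln `|alpha|)); first exact: expR_ge0.
move=> v v0.
have lna := ln_alpha_lt0 halpha.
have nv : 0 < nrm v by rewrite nrm_gt0.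
have nF : 0 < nrm (F v) by rewrite nrm_gt0 F0.
rewrite -ler_ln ?posrE ?mulr_gt0 ?expR_gt0 ?exprz_gt0//.
rewrite lnM ?posrE ?expR_gt0 ?exprz_gt0// expRK ln_exprz//.
have := hC _ v0; rewrite /vlevel mulrA -mulrBl ler_ndivrMr//; lra.
Qed.

Lemma line_growth_pos F (M : R) p q :
  (forall v, v != 0 -> nrm (F v) <= M * nrm v) -> 0 <= M -> cdet p q != 0 ->
  exists K, forall z, nrm (F (p + z *: q)) <= K * (1 + normc z).
Proof.
move=> hM M0 pq; exists (M * (nrm p + nrm q)) => z.
apply: le_trans (hM _ (cdet_line_neq0 z pq)) _.
rewrite -mulrA ler_wpM2l//; apply: le_trans (nrmD _ _) _; rewrite nrmZ.
have := normc_ge0 z; have := nrm_ge0 p; have := nrm_ge0 q => hq hp hz.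
have := mulr_ge0 hp hz; lra.
Qed.

Lemma line_growth_neg F (M : R) p q :
  (forall v, v != 0 -> nrm (F v) <= M / nrm v) -> 0 <= M -> cdet p q != 0 ->
  exists K, forall z, nrm (F (p + z *: q)) <= K * (1 + normc z).
Proof.
move=> hM M0 pq; exists (M * (2 * nrm q / normc (cdet p q))) => z.
have w0 := cdet_line_neq0 z pq.
apply: le_trans (hM _ w0) _.
rewrite -[leRHS]mulrA ler_wpM2l//.
have d0 : 0 < normc (cdet p q) by rewrite normc_gt0.
have nw : 0 < nrm (p + z *: q) by rewrite nrm_gt0.
have := cdet_line_bound p q z => h.
apply: le_trans (_ : 2 * nrm q / normc (cdet p q) <= _).
  by rewrite ler_pdivlMr// mulrC ler_pdivrMr.
rewrite -[leLHS]mulr1 ler_wpM2l//; last by rewrite lerDl normc_ge0.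
by rewrite divr_ge0 ?mulr_ge0 ?nrm_ge0 ?normc_ge0.
Qed.

Lemma cdet_neq0_l p q : cdet p q != 0 -> p != 0.
Proof. by move=> /(cdet_line_neq0 0); rewrite scale0r addr0. Qed.

Lemma cdet_neq0_r p q : cdet p q != 0 -> q != 0.
Proof. by apply: contraNneq => ->; rewrite /cdet !mxE !mulr0 subrr. Qed.

Lemma equivariant_additive F :
  (forall v, v != 0 -> F v != 0) -> (forall v, v != 0 -> differentiable F v) ->
  (forall n v, v != 0 -> F (al ^ n *: v) = al ^ n *: F v) ->
  forall p q z, cdet p q != 0 -> F (p + z *: q) = F p + z *: F q.
Proof.
move=> F0 dF Fal p q z pq.
have [|M M0 hM] := @equivariant_growth F 1 F0 dF.
  by move=> n v v0; rewrite mul1r Fal.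
have [|K hK] := @line_growth_pos F M p q _ M0 pq.
  by move=> v v0; have := hM _ v0; rewrite expr1z.
have aff := line_affine dF pq hK; rewrite aff; congr (_ + _ *: _).
set c := F (p + q) - F p.
have q0 := cdet_neq0_r pq; have p0 := cdet_neq0_l pq.
apply/eqP; rewrite -subr_eq0 -nrm_eq0 eq_le nrm_ge0 andbT.
apply/ler_addgt0Pl => e e0; rewrite addr0.
have e2 : 0 < e / 2 by lra.
have [d d0 hd] := differentiable_vcont (dF _ q0) e2.
have np := nrm_ge0 p; have nFp := nrm_ge0 (F p).
have [|n hn] := @alX_small _ _ halpha (Num.min (d / (1 + nrm p)) (e / 2 / (1 + nrm (F p)))).
  by rewrite lt_min !divr_gt0//; lra.
have nc : normc (al ^ n%:Z) = `|alpha| ^+ n.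
  by rewrite -fmorphXz /= expr0n/= addr0 sqrtr_sqr normrX.
have an := exprn_ge0 n (normr_ge0 alpha).
have D1 : 0 < 1 + nrm p by lra.
have D2 : 0 < 1 + nrm (F p) by lra.
move: hn; rewrite lt_min !ltr_pdivlMr//.
move=> /andP[n1 n2].
have E : F (al ^ n%:Z *: p + q) = al ^ n%:Z *: F p + c.
  have an0 : al ^ n%:Z != 0 by exact: alX_neq0.
  have -> : al ^ n%:Z *: p + q = al ^ n%:Z *: (p + (al ^ n%:Z)^-1 *: q).
    by rewrite scalerDr scalerA mulfV// scale1r.
  rewrite Fal; last exact: cdet_line_neq0.
  by rewrite aff scalerDr scalerA mulfV// scale1r.
have := hd (al ^ n%:Z *: p + q); rewrite addrK nrmZ nc E => h.
have {}h : nrm (al ^ n%:Z *: F p + c - F q) < e / 2 by apply: h; lra.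
have -> : c - F q = (al ^ n%:Z *: F p + c - F q) - al ^ n%:Z *: F p.
  by rewrite -[X in _ = X - _]addrA [RHS]addrAC subrr add0r.
apply: le_trans (nrmD _ _) _; rewrite nrmN !nrmZ nc.
lra.
Qed.

(** Additivity is known only for independent vectors. Homogeneity on q follows by reading F (p + z
    q) along q and along z q, for an auxiliary p. Vectors on a coordinate axis are treated apart,
    because nothing is known of F at 0. *)
Lemma equivariant_linear F :
  (forall v, v != 0 -> F v != 0) -> (forall v, v != 0 -> differentiable F v) ->
  (forall n v, v != 0 -> F (al ^ n *: v) = al ^ n *: F v) ->
  exists A : 'M[R[i]]_2, forall v, v != 0 -> F v = A *m v.
Proof.
move=> F0 dF Fal.
have add := equivariant_additive F0 dF Fal.
have cdetZ p q z : cdet p (z *: q) = z * cdet p q by rewrite /cdet !mxE; ring.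
have hom p q z : cdet p q != 0 -> z != 0 -> F (z *: q) = z *: F q.
  move=> pq z0; apply: (addrI (F p)); rewrite -add//.
  by rewrite -[in RHS](scale1r (z *: q)) add ?scale1r// cdetZ mulf_neq0.
pose e1 : V := vec 1 0; pose e2 : V := vec 0 1.
have c12 : cdet e1 e2 != 0 by rewrite /cdet !vec0 !vec1 mulr1 mulr0 subr0 oner_neq0.
have c21 : cdet e2 e1 != 0.
  by rewrite /cdet !vec0 !vec1 mulr1 mulr0 sub0r oppr_eq0 oner_neq0.
have vE v : v = v 0 0 *: e1 + v 1 0 *: e2.
  by apply: cV2P; rewrite !mxE /= ?mulr1 ?mulr0 ?addr0 ?add0r.
pose A : 'M[R[i]]_2 := \matrix_(i, j) (if j == 0 then F e1 i 0 else F e2 i 0).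
have AE v : A *m v = v 0 0 *: F e1 + v 1 0 *: F e2.
  apply/matrixP => i j; rewrite (ord1 j) !mxE !big_ord_recl big_ord0 addr0 !mxE /=.
  by congr (_ + _); rewrite mulrC; congr (v _ _ * _); exact: val_inj.
exists A => v v0; rewrite AE.
rewrite [in LHS](vE v).
have [v00|v00] := eqVneq (v 0 0) 0.
  rewrite v00 !scale0r !add0r (hom e1)//.
  by apply: contraNneq v0 => v10; rewrite (vE v) v00 v10 !scale0r addr0.
have [v10|v10] := eqVneq (v 1 0) 0.
  by rewrite v10 !scale0r !addr0 (hom e2).
have cc : cdet (v 0 0 *: e1) e2 != 0.
  by rewrite /cdet !mxE/= !mulr1 !mulr0 subr0.
by rewrite add// (hom e2).
Qed.

(** At z = alpha^-n the affine formula reads F p + alpha^-n c = alpha^n F (alpha^n p + q), where F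
    stays bounded near q. Multiplied by alpha^n it gives c = 0 in the limit; then the formula itself
    gives F p = 0. *)
Lemma no_contravariant F :
  (forall v, v != 0 -> F v != 0) -> (forall v, v != 0 -> differentiable F v) ->
  ~ (forall n v, v != 0 -> F (al ^ n *: v) = al ^ (- n) *: F v).
Proof.
move=> F0 dF Fal.
have [p [q pq]] : exists p q : V, cdet p q != 0.
  by exists (vec 1 0), (vec 0 1); rewrite /cdet !vec0 !vec1 mulr1 mulr0 subr0 oner_neq0.
have p0 := cdet_neq0_l pq; have q0 := cdet_neq0_r pq.
have [|M M0 hM] := @equivariant_growth F (-1) F0 dF.
  by move=> n v v0; rewrite mulN1r Fal.
have [|K hK] := @line_growth_neg F M p q _ M0 pq.
  by move=> v v0; have := hM _ v0; rewrite exprN1.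
have aff := line_affine dF pq hK.
set c := F (p + q) - F p in aff.
have [d d0 hd] := differentiable_vcont (dF _ q0) ltr01.
set B := nrm (F q) + 1.
have hB u : nrm (u - q) < d -> nrm (F u) <= B.
  by move=> /hd h; have := nrmD (F u - F q) (F q); rewrite subrK /B; lra.
have B0 : 0 <= B by rewrite addr_ge0 ?nrm_ge0.
have E n : F p + (al ^ n)^-1 *: c = al ^ n *: F (al ^ n *: p + q).
  rewrite -aff.
  have -> : al ^ n *: p + q = al ^ n *: (p + (al ^ n)^-1 *: q).
    by rewrite scalerDr scalerA mulfV ?alX_neq0// scale1r.
  rewrite Fal ?cdet_line_neq0// scalerA -expfzDr ?(al_neq0 halpha)//.
  by rewrite addrN expr0z scale1r.
have nc (n : nat) : normc (al ^ n) = `|alpha| ^+ n.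
  by rewrite -fmorphXz /= expr0n/= addr0 sqrtr_sqr normrX.
have near (n : nat) : `|alpha| ^+ n < d / (1 + nrm p) -> nrm (F (al ^ n *: p + q)) <= B.
  move=> h; apply: hB; rewrite addrK nrmZ nc; move: h.
  have D1 : 0 < 1 + nrm p by rewrite ltr_wpDr ?nrm_ge0.
  rewrite ltr_pdivlMr//.
  have := exprn_ge0 n (normr_ge0 alpha); lra.
have np := nrm_ge0 p; have nFp := nrm_ge0 (F p).
have dp : 0 < d / (1 + nrm p) by rewrite divr_gt0//; lra.
have c0 : c = 0.
  apply/eqP; rewrite -nrm_eq0 eq_le nrm_ge0 andbT.
  apply/ler_addgt0Pl => e e0; rewrite addr0.
  have D0 : 0 < 1 + B + nrm (F p) by lra.
  pose d1 := Num.min (d / (1 + nrm p)) (e / (1 + B + nrm (F p))).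
  have [|n] := @alX_small _ _ halpha (Num.min 1 d1).
    by rewrite !lt_min ltr01 dp divr_gt0.
  rewrite /d1 !lt_min [_ < e / _]ltr_pdivlMr// => /and3P[n1 /near hn n2].
  have an := exprn_ge0 n (normr_ge0 alpha).
  have -> : c = al ^ n *: (al ^ n *: F (al ^ n *: p + q)) - al ^ n *: F p.
    rewrite -E scalerDr scalerA mulfV ?(alX_neq0 halpha)// scale1r addrAC subrr add0r.
    by [].
  apply: le_trans (nrmD _ _) _; rewrite nrmN !nrmZ nc.
  have h1 : `|alpha| ^+ n * nrm (F (al ^ n *: p + q)) <= B.
    rewrite -[leRHS]mul1r; apply: ler_pM => //; [exact: nrm_ge0|exact: ltW].
  have := ler_wpM2l an h1; lra.
have := F0 _ p0; rewrite -nrm_gt0 => Fp.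
have D0 : 0 < 1 + B by lra.
have [|n] := @alX_small _ _ halpha (Num.min (d / (1 + nrm p)) (nrm (F p) / (1 + B))).
  by rewrite !lt_min dp divr_gt0.
rewrite !lt_min [_ < nrm (F p) / _]ltr_pdivlMr// => /andP[/near hn n2].
have an := exprn_ge0 n (normr_ge0 alpha).
have := E n; rewrite c0 scaler0 addr0 => /(congr1 nrm); rewrite nrmZ nc => h.
have := ler_wpM2l an hn; lra.
Qed.

End EquivariantMaps.

(** * The action of Spin^c(3) *)

Section CircleAndSU2.
Context {R : realType}.
Local Notation V := 'cV[R[i]]_2.
Local Notation M := 'M[R[i]]_2.
Implicit Types (s t : R) (v w : V) (A U : M) (n : int).

(** With the factor pi, adding 1 to t changes the sign, just as alpha differs from |alpha| by a
    sign. *)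
Definition cis t : R[i] := cos (pi * t) +i* sin (pi * t).

Lemma cisD s t : cis (s + t) = cis s * cis t.
Proof.
apply/eqP; rewrite eq_complex /cis mulrDr cosD sinD /=.
by rewrite eqxx/= addrC [cos _ * sin _]mulrC; apply/eqP; ring.
Qed.

Lemma cis0 : cis 0 = 1.
Proof. by rewrite /cis mulr0 cos0 sin0. Qed.

Lemma cis1 : cis 1 = -1.
Proof. by rewrite /cis mulr1 cospi sinpi; apply/eqP; rewrite eq_complex/= oppr0 !eqxx. Qed.

Lemma cis_neq0 t : cis t != 0.
Proof.
apply: contraTneq (oner_neq0 R[i]) => c0; rewrite -cis0 -(subrr t) cisD c0 mul0r.
by rewrite eqxx.
Qed.

Lemma cisN t : cis (- t) = (cis t)^-1.
Proof. by apply: (mulfI (cis_neq0 t)); rewrite -cisD subrr cis0 mulfV// cis_neq0. Qed.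

Lemma cis_int n : cis n%:~R = (-1) ^ n.
Proof.
have cn (k : nat) : cis k%:R = (-1) ^+ k.
  by elim: k => [|k IH]; rewrite ?cis0// -natr1 cisD IH cis1 exprSr.
by case: n => k; rewrite ?NegzE ?mulrNz ?cisN -pmulrn cn.
Qed.

Lemma signz_cases n : (-1) ^ n = 1 :> R[i] \/ (-1) ^ n = -1 :> R[i].
Proof.
case: n => k; rewrite ?NegzE -?exprnN -?exprnP -signr_odd; case: (odd _);
  rewrite ?expr0 ?expr1 ?invr1 ?invrN1; by [left|right].
Qed.

Lemma cis_real s : Im (cis s) = 0 -> exists n, s = n%:~R.
Proof.
move=> s0; exists (Num.floor s).
have /andP[f0 f1] := real_floor_itv (num_real s); rewrite rmorphD/= in f1.
set n := Num.floor s in f0 f1 *; set r := s - n%:~R.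
have sr : s = n%:~R + r by rewrite /r addrC subrK.
have r0 : sin (pi * r) = 0.
  move: s0; rewrite sr cisD cis_int; case: (signz_cases n) => ->; first by rewrite mul1r.
  by rewrite mulN1r /= => /eqP; rewrite oppr_eq0 => /eqP.
apply/eqP; rewrite eq_le f0 andbT leNgt; apply/negP => ns.
have rgt : 0 < r by rewrite subr_gt0.
have r1 : r < 1 by rewrite /r; lra.
have : 0 < pi * r < pi by rewrite mulr_gt0 ?pi_gt0//= -[ltRHS]mulr1 ltr_pM2l ?pi_gt0.
by move/sin_gt0_pi; rewrite r0 ltxx.
Qed.

Lemma normc_cis t : normc (cis t) = 1.
Proof. by rewrite /= cos2Dsin2 sqrtr1. Qed.

Lemma cis_surj (u : R[i]) : normc u = 1 -> exists t, u = cis t.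
Proof.
case: u => x y u1.
have xy : x ^+ 2 + y ^+ 2 = 1.
  by move: u1 => /= /(congr1 (fun z => z ^+ 2)); rewrite sqr_sqrtr ?expr1n// addr_ge0 ?sqr_ge0.
have x1 : -1 <= x <= 1 by rewrite -ler_norml -u1; exact: (abs_Re_le (x +i* y)).
have pi0 : pi != 0 :> R by rewrite gt_eqF// pi_gt0.
have sy : sin (acos x) = `|y|.
  by rewrite sin_acos// -xy addrC addKr sqrtr_sqr.
have cx : cos (acos x) = x by apply: acosK; rewrite in_itv.
have [y0|y0] := leP 0 y.
  exists (acos x / pi); rewrite /cis mulrC divfK// cx sy ger0_norm//.
exists (- (acos x / pi)); rewrite /cis mulrN mulrC divfK// cosN sinN cx sy ltr0_norm//.
by rewrite opprK.
Qed.

Lemma det2 A : \det A = A 0 0 * A 1 1 - A 0 1 * A 1 0.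
Proof.
rewrite (expand_det_row _ ord0) !big_ord_recl big_ord0 addr0 /cofactor !det_mx11 !mxE/=.
rewrite expr0 expr1 mul1r mulN1r mulrN; congr (A _ _ * A _ _ - A _ _ * A _ _);
  exact: val_inj.
Qed.

Lemma mulmx2 A v i : (A *m v) i 0 = A i 0 * v 0 0 + A i 1 * v 1 0.
Proof.
rewrite mxE !big_ord_recl big_ord0 addr0.
by congr (A _ _ * v _ _ + A _ _ * v _ _); exact: val_inj.
Qed.

Lemma Jvec0 v : Jvec v 0 0 = - conjc (v 1 0). Proof. by rewrite mxE. Qed.
Lemma Jvec1 v : Jvec v 1 0 = conjc (v 0 0). Proof. by rewrite mxE. Qed.

Lemma conjcM (a b : R[i]) : conjc (a * b) = conjc a * conjc b.
Proof. exact: rmorphM. Qed.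
Lemma conjcD (a b : R[i]) : conjc (a + b) = conjc a + conjc b.
Proof. exact: rmorphD. Qed.
Lemma conjcN (a : R[i]) : conjc (- a) = - conjc a.
Proof. exact: rmorphN. Qed.

(* Matrices commuting with [J] are the quaternions. *)
Definition quaternionic A := A 1 1 = conjc (A 0 0) /\ A 0 1 = - conjc (A 1 0).

Lemma quaternionic_Jvec A v : quaternionic A -> Jvec (A *m v) = A *m Jvec v.
Proof.
move=> [h1 h2]; apply: cV2P; rewrite ?Jvec0 ?Jvec1 !mulmx2 ?Jvec0 ?Jvec1 h1 h2.
  by rewrite !conjcD !conjcM !conjcK; ring.
by rewrite !conjcD !conjcM conjcN !conjcK; ring.
Qed.

(** The image of (1, 0) already gives both relations. *)
Lemma Jvec_quaternionic A : (forall v, v != 0 -> Jvec (A *m v) = A *m Jvec v) ->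
  quaternionic A.
Proof.
move=> h; have e0 : vec 1 0 != 0 :> V by rewrite vec_eq0 negb_and oner_neq0.
have := h _ e0 => E.
have := congr1 (fun v : V => v 0 0) E; rewrite Jvec0 !mulmx2 Jvec0 Jvec1 vec0 vec1 => E0.
have := congr1 (fun v : V => v 1 0) E; rewrite Jvec1 !mulmx2 Jvec0 Jvec1 vec0 vec1 => E1.
move: E0 E1; rewrite !mulr1 !mulr0 conjc0 oppr0 !mulr0 conjc1 !mulr1 !addr0 !add0r => E0 E1.
by split.
Qed.

(** The inverse is both the conjugate transpose and the adjugate. Entrywise, each left side is
    multiplied by the squared norm 1 of the first column, then reduced by the determinant and the
    orthogonality of the columns. *)
Lemma SU2_quaternionic (U : SU2 R) : quaternionic (val U).
Proof.
have d := SU2_det U; rewrite det2 in d.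
have u := SU2_mulVmx U.
move: (val U) d u => A d u.
have E i j : (conjc (A 0 i) * A 0 j + conjc (A 1 i) * A 1 j) = (i == j)%:R.
  have := congr1 (fun B : M => B i j) u; rewrite !mxE !big_ord_recl big_ord0 addr0 !mxE => <-.
  by congr (conjc (A _ _) * A _ _ + conjc (A _ _) * A _ _); exact: val_inj.
have E00 := E 0 0; have E01 := E 0 1; rewrite /= in E00 E01.
split.
- rewrite -[LHS]mul1r -[1]E00.
  transitivity (conjc (A 0 0) * (A 0 0 * A 1 1 - A 0 1 * A 1 0)
    + A 1 0 * (conjc (A 0 0) * A 0 1 + conjc (A 1 0) * A 1 1)); first by ring.
  by rewrite d E01 mulr1 mulr0 addr0.
rewrite -[LHS]mul1r -[1]E00.
transitivity (A 0 0 * (conjc (A 0 0) * A 0 1 + conjc (A 1 0) * A 1 1)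
    - conjc (A 1 0) * (A 0 0 * A 1 1 - A 0 1 * A 1 0)); first by ring.
by rewrite d E01 mulr1 mulr0 sub0r.
Qed.

(** [d] is the determinant of A, the squared norm of the quaternion, and r is its square root; d = 0
    would make A vanish. *)
Lemma quaternionic_polar A v : quaternionic A -> A *m v != 0 ->
  exists r : R, 0 < r /\ exists U : SU2 R, A = r%:C *: val U.
Proof.
move=> [h1 h2] Av.
pose d : R := Re (A 0 0) ^+ 2 + Im (A 0 0) ^+ 2 + (Re (A 1 0) ^+ 2 + Im (A 1 0) ^+ 2).
have dE : d%:C = A 0 0 * conjc (A 0 0) + A 1 0 * conjc (A 1 0).
  by rewrite /d; case: (A 0 0) (A 1 0) => [a b] [c e]; apply/eqP; rewrite eq_complex/=;
     apply/andP; split; apply/eqP; ring.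
have d0 : 0 < d.
  rewrite lt0r; apply/andP; split; last by rewrite !addr_ge0 ?sqr_ge0.
  apply: contraNneq Av => d0; move: d0; rewrite /d => /eqP.
  rewrite paddr_eq0 ?addr_ge0 ?sqr_ge0// !paddr_eq0 ?sqr_ge0// !sqrf_eq0.
  move=> /andP[/andP[/eqP a0 /eqP a1] /andP[/eqP b0 /eqP b1]].
  have A00 : A 0 0 = 0 by apply/eqP; rewrite eq_complex a0 a1 !eqxx.
  have A10 : A 1 0 = 0 by apply/eqP; rewrite eq_complex b0 b1 !eqxx.
  apply/eqP/cV2P; rewrite mulmx2 ?h1 ?h2 A00 A10 conjc0 ?oppr0 !mul0r addr0 mxE //.
pose r := Num.sqrt d; have r0 : 0 < r by rewrite sqrtr_gt0.
have rC : r%:C != 0 by rewrite (inj_eq (@complexI _) r 0) gt_eqF.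
have r2 : r%:C * r%:C = d%:C by rewrite -rmorphM -expr2 sqr_sqrtr// ltW.
exists r; split => //.
pose B : M := (r%:C)^-1 *: A.
have rV : (r%:C)^-1 * (r%:C)^-1 * d%:C = 1 by rewrite -r2; field.
have cr : conjc (r%:C)^-1 = (r%:C)^-1 by rewrite conjc_inv conjc_real.
have Bu : (B \is unitarymx) && (\det B == 1).
  apply/andP; split; last first.
    rewrite det2 !mxE h1 h2 -rV dE; apply/eqP; ring.
  apply/unitarymxP/mulmx1C/matrixP => i j.
  rewrite !mxE !big_ord_recl big_ord0 addr0 !mxE.
  rewrite -![Num.conj _]/(conjc _) !conjcM !cr.
  have -> : lift ord0 ord0 = 1 :> 'I_2 by exact: val_inj.
  have -> : ord0 = 0 :> 'I_2 by exact: val_inj.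
  have [i1 i0] : (1 : 'I_2) = 1 /\ (0 : 'I_2) = 0 by [].
  have ij (k : 'I_2) : k = 0 \/ k = 1.
    by case: k => [[|[|//]]] hk; [left|right]; exact: val_inj.
  case: (ij i) (ij j) => -> [] -> /=; rewrite ?h1 ?h2 ?conjcN ?conjcK -?rV ?dE; ring.
by exists (exist _ B Bu); rewrite /= /B scalerA mulfV// scale1r.
Qed.

End CircleAndSU2.

(** * The action on the Hopf surface *)

Section SpincAction.
Context {R : realType} {alpha : R} (halpha : -1 < alpha < 0).
Local Notation V := 'cV[R[i]]_2.
Local Notation M := 'M[R[i]]_2.
Local Notation H := (Hopf halpha).
Local Notation al := (alpha%:C : R[i]).
Local Notation proj := (vproj halpha).
Implicit Types (v w : V) (n : int) (A B : M) (s t : R) (u : S1 R) (U : SU2 R).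

Lemma vcont_continuous (F : V -> V) : (forall v, vcont F v) -> continuous F.
Proof.
move=> h v; apply/(@cvgrPdist_lt _ _ _ (nbhs v)) => e e0.
have eE : (Re e)%:C = e by apply: RRe_real; exact: gtr0_real.
have [|d d0 hd] := h v (Re e); first by rewrite -ltcR eE.
by apply/nbhs_nrmP; exists d => // w /hd; rewrite nrmE nrmB -eE ltcR.
Qed.

Lemma lipschitz_vcont (F : V -> V) (K : R) : 0 <= K ->
  (forall v w, nrm (F v - F w) <= K * nrm (v - w)) -> forall v, vcont F v.
Proof.
move=> K0 h v e e0; exists (e / (1 + K)) => [|w]; first by rewrite divr_gt0//; lra.
rewrite ltr_pdivlMr; last lra.
have := h w v; have := nrm_ge0 (w - v); lra.
Qed.

Lemma nrm_mulmx_le A : exists2 K, 0 <= K & forall v, nrm (A *m v) <= K * nrm v.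
Proof.
exists (normc (A 0 0) + normc (A 0 1) + (normc (A 1 0) + normc (A 1 1))).
  by rewrite !addr_ge0 ?normc_ge0.
move=> v; apply: le_trans (nrm_le_coord _) _; rewrite !mulmx2.
have row (i : 'I_2) : normc (A i 0 * v 0 0 + A i 1 * v 1 0) <=
    (normc (A i 0) + normc (A i 1)) * nrm v.
  apply: le_trans (normc_leD _ _) _; rewrite !normcM mulrDl.
  by apply: lerD; apply: ler_wpM2l; rewrite ?normc_ge0 ?coord_le_nrm.
by rewrite mulrDl; apply: lerD.
Qed.

Lemma mulmx_differentiable A v : differentiable (fun w => A *m w) v.
Proof.
have [K K0 hK] := nrm_mulmx_le A.
apply/differentiable_nrmP; exists (mulmx A : {linear V -> V}).
  apply: vcont_continuous; apply: (lipschitz_vcont K0) => w w'.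
  by rewrite -mulmxBr.
by move=> e e0; exists 1 => // w _; rewrite /= mulmxBr subrr nrm0 mulr_ge0 ?nrm_ge0 ?ltW.
Qed.

(** For A in SU(2), a lift to C^2 of the action of the class of (cis t, A). It depends on t, which
    [cis t] determines only modulo 2. *)
Definition act t A v : V := (`|alpha| `^ t)%:C *: (A *m v).

Lemma act_mx t A v : act t A v = ((`|alpha| `^ t)%:C *: A) *m v.
Proof. by rewrite /act -scalemxAl. Qed.

Lemma powC_neq0 t : (`|alpha| `^ t)%:C != 0 :> R[i].
Proof. by rewrite (inj_eq (@complexI _) _ 0) gt_eqF// powR_gt0// (alpha_norm_gt0 halpha). Qed.

Lemma act_neq0 t U v : v != 0 -> act t (val U) v != 0.
Proof.
move=> v0; rewrite /act scaler_eq0 (negbTE (powC_neq0 t))/=.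
apply: contraNneq v0 => /(congr1 (mulmx (val (SU2_inv U)))).
by rewrite /= mulmxA SU2_mulVmx mul1mx mulmx0 => ->.
Qed.

Lemma act_act s t A B v : act s A (act t B v) = act (s + t) (A *m B) v.
Proof.
rewrite /act -scalemxAr scalerA mulmxA -rmorphM powRD//.
by apply/implyP => _; rewrite gt_eqF// (alpha_norm_gt0 halpha).
Qed.

Lemma act_alZ t A n v : act t A (al ^ n *: v) = al ^ n *: act t A v.
Proof. by rewrite /act -scalemxAr !scalerA mulrC. Qed.

Lemma act_differentiable t A v : differentiable (act t A) v.
Proof.
rewrite (_ : act t A = fun w => ((`|alpha| `^ t)%:C *: A) *m w).
  exact: mulmx_differentiable.
by apply/funext => w; exact: act_mx.
Qed.

Lemma al_signed n : al ^ n = (`|alpha| ^ n)%:C * (-1) ^ n.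
Proof.
rewrite fmorphXz -expfzMl; congr (_ ^ n).
by have /andP[_ a0] := halpha; rewrite ltr0_norm// rmorphN mulrN1 opprK.
Qed.

Lemma act_deck t A n v : act (t + n%:~R) ((-1) ^ n *: A) v = al ^ n *: act t A v.
Proof.
rewrite /act powRD; last by apply/implyP => _; rewrite gt_eqF// (alpha_norm_gt0 halpha).
rewrite powR_intmul// -scalemxAl !scalerA al_signed rmorphM; congr (_ *: _); ring.
Qed.

(** The sign is written as a power of -1 to match the deck transformations in [act_deck]. *)
Lemma spinc_classP u U u' U' : spinc_class u U = spinc_class u' U' <->
  exists n, val u' = (-1) ^ n * val u /\ val U' = (-1) ^ n *: val U.
Proof.
split.
  move=> /eqP/cq_projP[[-> ->]|[-> ->]].
    by exists 0; rewrite expr0z mul1r scale1r.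
  by exists 1; rewrite expr1z /= scaleN1r mulNmx mul1mx.
move=> [n [hu hU]]; apply/eqP/cq_projP.
case: (@signz_cases R n) hu hU => -> hu hU; [left|right]; congr pair; apply: val_inj => /=.
- by rewrite hu mul1r.
- by rewrite hU scale1r.
- by rewrite hu.
- by rewrite hU scaleN1r mulNmx mul1mx.
Qed.

Lemma proj_act_class u U t u' U' t' v : v != 0 -> val u = cis t -> val u' = cis t' ->
  spinc_class u U = spinc_class u' U' -> proj (act t (val U) v) = proj (act t' (val U') v).
Proof.
move=> v0 ut ut' /spinc_classP[n [hu hU]].
have c : cis (t' - t) = (-1) ^ n by rewrite cisD cisN -ut' -ut hu mulfK// ut cis_neq0.
have [|m tm] := @cis_real _ (t' - t).
  by rewrite c; case: (@signz_cases R n) => ->; rewrite ?raddfN/= ?oppr0.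
have nm : (-1) ^ n = (-1) ^ m :> R[i] by rewrite -c tm cis_int.
have -> : t' = t + m%:~R by rewrite -tm addrC subrK.
by rewrite hU nm act_deck proj_alZ// act_neq0.
Qed.

(** The two lifts differ by alpha^n, so U' = c U, and the determinant gives c^2 = 1. Up to the sign
    (-1)^n, c is a positive real, which must be 1; its logarithm gives t' = t + n. *)
Lemma spinc_class_eq u U t u' U' t' : val u = cis t -> val u' = cis t' ->
  (forall v, v != 0 -> proj (act t (val U) v) = proj (act t' (val U') v)) ->
  spinc_class u U = spinc_class u' U'.
Proof.
move=> ut ut' h.
have [|n hn] := @lift_unique _ _ halpha (act t (val U)) (act t' (val U')).
  move=> v v0; split; rewrite ?act_neq0 ?h//; exact/differentiable_vcont/act_differentiable.
have lin v : v != 0 -> val U' *m v = (al ^ n * (`|alpha| `^ (t - t'))%:C) *: (val U *m v).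
  move=> v0; have := hn _ v0; rewrite /act => /(congr1 (fun w => (`|alpha| `^ t')%:C^-1 *: w)).
  rewrite !scalerA mulVf ?powC_neq0// scale1r => ->; congr (_ *: _).
  rewrite powRB; last by apply/implyP => _; rewrite gt_eqF// (alpha_norm_gt0 halpha).
  by rewrite rmorphM fmorphV; ring.
set c := _ * _ in lin.
have UU : val U' = c *: val U.
  apply/matrixP => i j.
  have e : delta_mx j 0 != 0 :> V.
    by apply/eqP => /matrixP/(_ j 0); rewrite !mxE !eqxx => /eqP; rewrite oner_eq0.
  have := congr1 (fun w : V => w i 0) (lin _ e).
  by rewrite -colE scalemxAl -colE !mxE.
have c2 : c ^+ 2 = 1 by have := SU2_det U'; rewrite UU detZ SU2_det mulr1.
have rpos : 0 < `|alpha| ^ n * `|alpha| `^ (t - t').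
  by rewrite mulr_gt0 ?exprz_gt0 ?powR_gt0 ?(alpha_norm_gt0 halpha).
have cE : c = (-1) ^ n * (`|alpha| ^ n * `|alpha| `^ (t - t'))%:C.
  by rewrite /c al_signed rmorphM; ring.
have r1 : `|alpha| ^ n * `|alpha| `^ (t - t') = 1.
  have : (`|alpha| ^ n * `|alpha| `^ (t - t')) ^+ 2 = 1.
    apply: complexI; rewrite rmorphXn/= rmorph1 -c2 cE exprMn.
    by case: (@signz_cases R n) => ->; rewrite ?sqrrN expr1n mul1r.
  move=> /eqP; rewrite sqrf_eq1 => /orP[/eqP//|/eqP r1]; move: rpos; rewrite r1; lra.
apply/spinc_classP; exists n; split; last by rewrite UU cE r1 mulr1.
have tt : t' = t + n%:~R.
  have a0 := alpha_norm_gt0 halpha.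
  have := congr1 (@ln R) r1; rewrite ln1 lnM ?posrE ?exprz_gt0 ?powR_gt0// ln_exprz// ln_powR.
  rewrite -mulrDl => /eqP; rewrite mulf_eq0 (lt_eqF (ln_alpha_lt0 halpha)) orbF => /eqP; lra.
by rewrite ut' ut tt cisD cis_int mulrC.
Qed.

End SpincAction.

(** * Automorphisms commuting with the real structure *)

Section RealAutomorphisms.
Context {R : realType} {alpha : R} (halpha : -1 < alpha < 0).
Context {a : R[i]} (ha : a ^+ 2 = alpha%:C).
Local Notation V := 'cV[R[i]]_2.
Local Notation H := (Hopf halpha).
Local Notation al := (alpha%:C : R[i]).
Local Notation proj := (vproj halpha).
Local Notation holo := (holomorphic_map (@hopf_atlas _ _ halpha)).
Implicit Types (v w : V) (n : int) (F G : V -> V) (phi psi : H -> H).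

Lemma a_neq0 : a != 0.
Proof. exact: (sqrt_alpha_neq0 halpha ha). Qed.

Definition Jhalf v : V := Jvec (a *: v).

Lemma Jhalf_neq0 v : v != 0 -> Jhalf v != 0.
Proof.
move=> v0; have av0 : a *: v != 0 by rewrite scaler_eq0 negb_or a_neq0.
by have := Jvec_neq0 (toW (a *: v)); rewrite val_toW.
Qed.

Lemma sf_projV v : v != 0 -> sf ha (proj v) = proj (Jhalf v).
Proof.
move=> v0; rewrite /vproj sf_proj; congr hopf_proj; apply: val_inj => /=.
by rewrite !val_toW ?Jhalf_neq0.
Qed.

Lemma Jhalf_half v : v != 0 -> Jhalf (Jhalf v) = al *: v.
Proof.
move=> v0; have := congr1 val (J_f_half_sq halpha ha (toW v)).
by rewrite /= !val_toW.
Qed.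

Lemma JhalfE v : Jhalf v = conjc a *: Jvec v.
Proof. by apply: cV2P; rewrite /Jhalf ?Jvec0 ?Jvec1 !mxE/= conjcM ?mulrN. Qed.

Lemma Jhalf_alZ n v : Jhalf (al ^ n *: v) = al ^ n *: Jhalf v.
Proof.
rewrite !JhalfE; apply: cV2P; rewrite !mxE /= conjcM -fmorphXz conjc_real; ring.
Qed.

Lemma Jhalf_vcont v : vcont Jhalf v.
Proof.
have JB (u w : V) : Jvec u - Jvec w = Jvec (u - w) :> V.
  by apply: cV2P; rewrite ?mxE/= ?Jvec0 ?Jvec1 ?mxE/= conjcD conjcN ?opprD.
have nJ (u : V) : nrm (Jvec u) <= 2 * nrm u.
  apply: le_trans (nrm_le_coord _) _; rewrite Jvec0 Jvec1 normcN.
  have cj (z : R[i]) : normc (conjc z) = normc z by apply: complexI; rewrite -!normcC normcJ.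
  by rewrite !cj; have := coord_le_nrm u 0; have := coord_le_nrm u 1; lra.
apply: (@lipschitz_vcont _ _ (normc (conjc a) * 2)) => [|u w].
  by rewrite mulr_ge0 ?normc_ge0.
by rewrite !JhalfE -scalerBr nrmZ JB -mulrA ler_wpM2l ?normc_ge0.
Qed.

(** v |-> F (alpha v) is another lift of phi. *)
Lemma lift_equivariant phi F :
  (forall v, v != 0 -> [/\ F v != 0, proj (F v) = phi (proj v) & differentiable F v]) ->
  exists k, forall n v, v != 0 -> F (al ^ n *: v) = al ^ (k * n) *: F v.
Proof.
move=> hF.
have al1 v : al *: v = al ^ 1%:Z *: v by rewrite expr1z.
have av v : v != 0 -> al *: v != 0 by move=> v0; rewrite al1 (alZ_neq0 halpha).
have [|k hk] := @lift_unique _ _ halpha F (fun v => F (al *: v)).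
  move=> v v0; have [F0 pF dF] := hF _ v0; have [F0' pF' dF'] := hF _ (av _ v0).
  split => //.
  - by rewrite pF pF' al1 proj_alZ.
  - exact: differentiable_vcont dF.
  move=> e e0; have [d d0 hd] := differentiable_vcont dF' e0.
  exists (d / (1 + normc al)) => [|w]; first by rewrite divr_gt0//; have := normc_ge0 al; lra.
  have nal := normc_ge0 al; rewrite ltr_pdivlMr; last lra.
  move=> h; apply: hd; rewrite -scalerBr nrmZ.
  have := nrm_ge0 (w - v); lra.
exists k.
have pos (m : nat) v : v != 0 -> F (al ^ m%:Z *: v) = al ^ (k * m%:Z) *: F v.
  elim: m => [|m IH] v0; first by rewrite mulr0 expr0z !scale1r.
  rewrite -exprnP exprS -scalerA hk; last by rewrite exprnP (alZ_neq0 halpha).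
  rewrite exprnP IH// scalerA -expfzDr ?(al_neq0 halpha)//.
  by congr (_ ^ _ *: _); rewrite -[m.+1]add1n PoszD mulrDr mulr1.
move=> [m|m] v v0; first exact: pos.
have w0 : al ^ Negz m *: v != 0 by rewrite (alZ_neq0 halpha).
have := pos m.+1 _ w0.
rewrite scalerA -expfzDr ?(al_neq0 halpha)// NegzE subrr expr0z scale1r => ->.
rewrite scalerA -expfzDr ?(al_neq0 halpha)//.
by rewrite mulrN addNr expr0z scale1r.
Qed.

Lemma real_aut_classification phi : real_aut ha phi ->
  exists (u : S1 R) (U : SU2 R) t, val u = cis t /\
    forall v, v != 0 -> phi (proj v) = proj (@act _ alpha t (val U) v).
Proof.
move=> [[psi [phiK psiK hphi hpsi]] comm].
have [F hF] := hopf_lift hphi; have [G hG] := hopf_lift hpsi.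
have [k hk] := lift_equivariant hF; have [l hl] := lift_equivariant hG.
have F0 v : v != 0 -> F v != 0 by move=> /hF[].
have dF v : v != 0 -> differentiable F v by move=> /hF[].
have cF v : v != 0 -> vcont F v by move=> v0; exact/differentiable_vcont/dF.
have vcont_id v : vcont (fun w => w) v by move=> e e0; exists e.
have vcont_comp (f g : V -> V) v : vcont g (f v) -> vcont f v -> vcont (fun w => g (f w)) v.
  by move=> hg hf e /hg[d /hf[d' d'0 h] hd]; exists d' => // w /h; exact: hd.
have e1 : vec 1 1 != 0 :> V by exact: e1_neq0.
have al0 := al_neq0 halpha.
(* v |-> G (F v) lifts the identity, so it is a power of alpha; comparing exponents at alpha v gives
   the equation. *)
have lk : l * k = 1.
  have [|m hm] := @lift_unique _ _ halpha (fun v => v) (fun v => G (F v)).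
    move=> v v0; have [Fv pF _] := hF _ v0; have [GF pG dG] := hG _ Fv.
    split => //; first by rewrite pG pF phiK.
    by apply: vcont_comp; [exact: differentiable_vcont dG|exact: cF].
  have w0 : al ^ 1%:Z *: vec 1 1 != 0 :> V by rewrite (alZ_neq0 halpha).
  have := hm _ w0; rewrite hk// hl ?F0// hm// !scalerA -!expfzDr//.
  have := hm _ e1 => _; rewrite mulr1 => h.
  have : al ^ (l * k + m) = al ^ (m + 1).
    have := congr1 (fun v : V => v 0 0) h; rewrite !mxE/= !mulr1.
    by [].
  by move/(alX_inj halpha); lia.
have k1 : k = 1 \/ k = -1.
  by have := congr1 absz lk; rewrite abszM => /eqP; rewrite muln_eq1 => /andP[_ /eqP]; lia.
have {}k1 : k = 1.
  case: k1 => // kN; exfalso; apply: (@no_contravariant _ _ halpha F) => // n v v0.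
  by rewrite hk// kN mulN1r.
have [|A hA] := @equivariant_linear _ _ halpha F F0 dF.
  by move=> n v v0; rewrite hk// k1 mul1r.
have [|m hm] := @lift_unique _ _ halpha (fun v => F (Jhalf v)) (fun v => Jhalf (F v)).
  move=> v v0; have [Fv pF _] := hF _ v0; have hv := Jhalf_neq0 v0; have [Fhv pFh _] := hF _ hv.
  split => //; first exact: Jhalf_neq0.
  - by rewrite pFh -sf_projV// -sf_projV// pF -[RHS]/((sf ha \o phi) _) -comm.
  - by apply: vcont_comp; [exact: cF|exact: Jhalf_vcont].
  by apply: vcont_comp; [exact: Jhalf_vcont|exact: cF].
(* [Jhalf] is antilinear but commutes with powers of alpha, alpha being real, and its square is
   alpha. Passing it twice through F gives alpha^(2 m + 1) = alpha on F v. *)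
have m0 : m = 0.
  have h1 := hm _ (Jhalf_neq0 e1).
  have al1 v : al *: v = al ^ 1%:Z *: v by rewrite expr1z.
  rewrite Jhalf_half// al1 hk// k1 mul1r in h1.
  have h2 : Jhalf (F (vec 1 1)) = al ^ m *: F (Jhalf (vec 1 1)) := hm _ e1.
  have h3 := congr1 Jhalf h2; rewrite Jhalf_alZ Jhalf_half ?F0// h1 al1 !scalerA -!expfzDr// in h3.
  have := congr1 (@vlevel R alpha) h3; rewrite !(level_alZ halpha) ?F0// => /addrI/intr_inj; lia.
have qA : quaternionic A.
  apply: Jvec_quaternionic => v v0.
  have := hm _ v0; rewrite m0 expr0z scale1r !JhalfE (hA v v0) (hA _); last first.
    by rewrite -JhalfE Jhalf_neq0.
  rewrite -scalemxAr => /(congr1 (fun w => (conjc a)^-1 *: w)).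
  by rewrite !scalerA mulVf ?conjc_eq0 ?a_neq0// !scale1r.
have [|r [r0 [U AU]]] := @quaternionic_polar _ A (vec 1 1) qA; first by rewrite -hA ?F0.
pose t := ln r / ln `|alpha|.
have rt : r = `|alpha| `^ t.
  apply: ln_inj; rewrite ?posrE ?powR_gt0 ?(alpha_norm_gt0 halpha)//.
  by rewrite ln_powR divfK// lt_eqF// (ln_alpha_lt0 halpha).
have ut : `|cis t| == 1 by rewrite normcC normc_cis.
exists (exist _ (cis t) ut), U, t; split => // v v0.
by have [_ <- _] := hF _ v0; rewrite hA// AU rt act_mx.
Qed.

(** Commutation holds already for the lifts: a real scalar and a quaternionic matrix commute with
    [Jhalf]. *)
Lemma act_real_aut phi psi t s (U U' : SU2 R) : cancel phi psi -> cancel psi phi ->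
  (forall v, v != 0 -> phi (proj v) = proj (@act _ alpha t (val U) v)) ->
  (forall v, v != 0 -> psi (proj v) = proj (@act _ alpha s (val U') v)) ->
  real_aut ha phi.
Proof.
move=> phiK psiK hphi hpsi.
have holo chi r (B : SU2 R) :
    (forall v, v != 0 -> chi (proj v) = proj (@act _ alpha r (val B) v)) -> holo chi.
  move=> h; apply: (@induced_holomorphic _ _ halpha chi (@act _ alpha r (val B))) => [v v0|n v v0].
    by split; [exact: act_neq0|exact: h|exact: act_differentiable].
  rewrite (_ : (fun w => _) = (fun w => (al ^ n *: ((`|alpha| `^ r)%:C *: val B)) *m w)).
    exact: mulmx_differentiable.
  by apply/funext => w; rewrite act_mx scalemxAl.
split; first by exists psi; split => //; [exact: holo hphi|exact: holo hpsi].
apply/funext => x /=; have [v v0 <-] := proj_surj x.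
rewrite hphi// !sf_projV ?act_neq0// hphi ?Jhalf_neq0//; congr vproj.
rewrite !JhalfE /act -!scalemxAr -(quaternionic_Jvec _ (SU2_quaternionic U)) !scalerA mulrC.
rewrite -!scalerA; congr (_ *: _).
by apply: cV2P; rewrite !mxE/= conjcM conjc_real ?mulrN.
Qed.

End RealAutomorphisms.

(** * The isomorphism *)

Lemma angle_exists (R : realType) : exists ang : S1 R -> R, forall u, val u = cis (ang u).
Proof.
suff /choice[ang hang] : forall u : S1 R, exists t, val u = cis t by exists ang.
by move=> u; apply: cis_surj; apply: complexI; rewrite -normcC; exact/eqP/(valP u).
Qed.

(** Phi is built from arbitrary representatives of the class, the angle and the point; the formula,
    for every admissible t and v, records the independence of these choices. *)
Lemma spinc_action_exists (R : realType) (alpha : R) (halpha : -1 < alpha < 0) :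
  exists Phi : Spinc3 R -> Hopf halpha -> Hopf halpha,
    forall (u : S1 R) (U : SU2 R) (t : R) (v : 'cV[R[i]]_2), val u = cis t -> v != 0 ->
      Phi (spinc_class u U) (vproj halpha v) = vproj halpha (@act _ alpha t (val U) v).
Proof.
have [ang hang] := angle_exists R.
pose Phi (g : Spinc3 R) (x : Hopf halpha) : Hopf halpha :=
  let uU := repr g in
  vproj halpha (@act _ alpha (ang uU.1) (val uU.2) (val (repr x : W R))).
exists Phi => u U t v ut v0; rewrite /Phi; case E : (repr (spinc_class u U)) => [u0 U0] /=.
have cE : spinc_class u U = spinc_class u0 U0.
  by rewrite -[LHS]reprK E.
have w0 := W_neq0 (repr (vproj halpha v) : W R).
have [n hn] : exists n, val (repr (vproj halpha v) : W R) = alpha%:C ^ n *: v.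
  by apply/(projP halpha) => //; rewrite proj_val /hopf_proj reprK.
rewrite hn; rewrite act_alZ; rewrite (proj_alZ halpha n (act_neq0 halpha (ang u0) U0 v0)).
by apply/esym; exact: (proj_act_class halpha v0 ut (hang u0) cE).
Qed.

(** Naturality is the last clause: it gives Phi by an explicit formula and determines it, since
    every class and every point of the surface is reached. *)
Theorem corollary4p4 (R : realType) (alpha : R) (halpha : -1 < alpha < 0)
    (a : R[i]) (ha : a ^+ 2 = alpha%:C) :
  exists Phi : Spinc3 R -> (Hopf halpha -> Hopf halpha),
    [/\ set_bij [set: Spinc3 R] (real_aut ha) Phi,
        forall g h : Spinc3 R, Phi (g * h)%g = Phi g \o Phi h &
        forall (u : S1 R) (U : SU2 R) (t : R),
          val u = cos (pi * t) +i* sin (pi * t) ->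
          forall v w : W R,
            val w = (`|alpha| `^ t)%:C *: (val U *m val v) ->
            Phi (spinc_class u U) (hopf_proj halpha v) = hopf_proj halpha w].
Proof.
have [Phi PhiE] := spinc_action_exists halpha.
have [ang hang] := angle_exists R.
have classK g : exists u U, g = spinc_class u U :> Spinc3 R.
  by have [[u U] ->] := cq_projS g; exists u, U.
have PhiM g h : Phi (g * h)%g = Phi g \o Phi h.
  have [u [U ->]] := classK g; have [u' [U' ->]] := classK h.
  have -> : (spinc_class u U * spinc_class u' U')%g = spinc_class (u * u')%g (U * U')%g.
    exact: cq_proj_mul.
  apply/funext => x; have [v v0 <-] := proj_surj x.
  (* [ang] need not be additive, but the sum of two angles is an admissible parameter for the
     product. *)
  have uu : val (u * u')%g = cis (ang u + ang u') by rewrite cisD -!hang.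
  rewrite (PhiE _ _ _ _ uu v0) -[RHS]/(Phi _ (Phi _ _)) (PhiE _ _ _ _ (hang u') v0).
  rewrite (PhiE _ _ _ _ (hang u) (act_neq0 halpha _ _ v0)).
  by rewrite (act_act halpha).
have Phi1 : Phi 1%g = id.
  have -> : (1%g : Spinc3 R) = spinc_class 1%g 1%g by [].
  apply/funext => x; have [v v0 <-] := proj_surj x.
  rewrite (PhiE _ _ 0 v)//; last by rewrite cis0.
  by rewrite /act powRr0 scale1r mul1mx.
have PhiK g : cancel (Phi g) (Phi g^-1%g).
  by move=> x; rewrite -[LHS]/((Phi g^-1%g \o Phi g) x) -PhiM mulVg Phi1.
have PhiVK g : cancel (Phi g^-1%g) (Phi g).
  by move=> x; rewrite -[LHS]/((Phi g \o Phi g^-1%g) x) -PhiM mulgV Phi1.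
exists Phi; split => //; last first.
  move=> u U t ut v w wE; rewrite -!proj_val (PhiE _ _ _ _ ut) ?W_neq0//.
  by rewrite wE.
split.
(* A representative of [g^-1] presents the inverse map in the same form, so its holomorphy needs no
   separate argument. *)
- move=> g _; have [u [U gE]] := classK g; have [u' [U' gE']] := classK g^-1%g.
  apply: (act_real_aut ha (t := ang u) (s := ang u') (U := U) (U' := U') (PhiK g) (PhiVK g)).
    by move=> v v0; rewrite gE (PhiE _ _ _ _ (hang u)).
  by move=> v v0; rewrite gE' (PhiE _ _ _ _ (hang u')).
- move=> g h _ _ gh; have [u [U gE]] := classK g; have [u' [U' hE]] := classK h.
  rewrite gE hE; apply: (spinc_class_eq (halpha := halpha) (hang u) (hang u')) => v v0.
  by rewrite -(PhiE _ _ _ _ (hang u))// -(PhiE _ _ _ _ (hang u'))// -gE -hE gh.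
move=> phi /real_aut_classification[u [U [t [ut h]]]].
exists (spinc_class u U) => //; apply/funext => x; have [v v0 <-] := proj_surj x.
by rewrite (PhiE _ _ _ _ ut)// h.
Qed.
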